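(* Let $M$ be a quaternion algebra over $\mathbb{Q}$ which is non-split (i.e. $M\not\cong M_2(\mathbb{Q})$) but splits over $\mathbb{R}$, and fix an isomorphism $\phi:M(\mathbb{R})=M\otimes_{\mathbb{Q}}\mathbb{R}\to M_2(\mathbb{R})$ with $N_{\mathrm{red}}(\alpha)=\det(\phi(\alpha))$ for all $\alpha\in M(\mathbb{R})$. Let $M(\mathbb{Z})$ be a maximal order of $M$ and $M^1(\mathbb{Z})=\{\alpha\in M(\mathbb{Z}):N_{\mathrm{red}}(\alpha)=1\}$. Then the group $\Gamma=\phi(M^1(\mathbb{Z}))/\{\pm1\}\subset\operatorname{PSL}_2(\mathbb{R})$ is a bounded gaps group, i.e. $0<\operatorname{LG}(\Gamma)<\infty$.
   Context: $N_{\mathrm{red}}$ denotes the reduced norm of the quaternion algebra. For an increasing sequence $(x_n)$ of positive reals, $\operatorname{LG}((x_n))=\liminf_{n\to\infty}|x_{n+1}-x_n|$. For a discrete subgroup $\Gamma\subset\operatorname{PSL}_2(\mathbb{R})$ of finite covolume: an element $\gamma\in\Gamma$ is hyperbolic if a lift $\pm g\in\operatorname{SL}_2(\mathbb{R})$ has $|\operatorname{tr} g|>2$; then $g$ has eigenvalues $\pm\lambda^{\pm1}$ with $\lambda>1$ and $N(\gamma)=\lambda$ (this is $e^{l(c)}$ for the corresponding closed geodesic $c$, with lengths normalized accordingly). $\gamma$ is primitive if it is not $\delta^k$ with $\delta\in\Gamma$, $k\ge2$. $N(\Gamma)$ is the sequence of distinct values $N(\gamma)$, $\gamma$ primitive hyperbolic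 in $\Gamma$, in increasing order; $\operatorname{LG}(\Gamma)=\operatorname{LG}(N(\Gamma))$, and $\Gamma$ is a bounded gaps group if $0<\operatorname{LG}(\Gamma)<\infty$. *)

(* Defs.v *)
From HB Require Import structures.
From mathcomp Require Import all_boot all_order all_algebra.
From mathcomp Require Import ring.
From mathcomp Require Import all_classical all_reals all_analysis.

Set Implicit Arguments.
Unset Strict Implicit.
Unset Printing Implicit Defensive.

Import Order.TTheory GRing.Theory Num.Theory.
Local Open Scope classical_set_scope.
Local Open Scope ring_scope.
Local Open Scope quotient_scope.

(* [quat a b] is the quaternion algebra (a, b | F), meaningful when a and b are
   nonzero and char F <> 2: [Quat x y z w] stands for x + y i + z j + w ij, with
   i^2 = a, j^2 = b and ji = - ij. *)
Record quat (F : fieldType) (a b : F) : Type :=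
  Quat { qre : F; qi : F; qj : F; qij : F }.

Arguments Quat {F a b}.

Section QuatAlgebra.
Variables (F : fieldType) (a b : F).
Local Notation Q := (quat a b).
Implicit Types u v : Q.

Definition quat_row u : 'rV[F]_4 :=
  \row_(k < 4) nth 0 [:: qre u; qi u; qj u; qij u] k.

Definition row_quat (r : 'rV[F]_4) : Q :=
  Quat (r 0 (inord 0)) (r 0 (inord 1)) (r 0 (inord 2)) (r 0 (inord 3)).

Lemma quat_rowK : cancel quat_row row_quat.
Proof. by case=> x y z w; rewrite /row_quat !mxE !inordK. Qed.

Lemma row_quatK : cancel row_quat quat_row.
Proof.
move=> r; apply/rowP => -[[|[|[|[|k]]]] hk] //; rewrite mxE /=;
  by congr (r 0 _); apply/val_inj; rewrite /= inordK.
Qed.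

HB.instance Definition _ := Choice.copy Q (can_type quat_rowK).

Definition quat_zero : Q := Quat 0 0 0 0.
Definition quat_one : Q := Quat 1 0 0 0.
Definition quat_opp u : Q := Quat (- qre u) (- qi u) (- qj u) (- qij u).
Definition quat_add u v : Q :=
  Quat (qre u + qre v) (qi u + qi v) (qj u + qj v) (qij u + qij v).
Definition quat_scale (c : F) u : Q :=
  Quat (c * qre u) (c * qi u) (c * qj u) (c * qij u).
Definition quat_mul u v : Q :=
  let: Quat x y z w := u in
  let: Quat x' y' z' w' := v in
  Quat (x * x' + a * (y * y') + b * (z * z') - a * b * (w * w'))
       (x * y' + y * x' - b * (z * w') + b * (w * z'))
       (x * z' + z * x' + a * (y * w') - a * (w * y'))
       (x * w' + w * x' + y * z' - z * y').

Lemma quat_addA : associative quat_add.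
Proof. by case=> ? ? ? ? [? ? ? ?] [? ? ? ?]; congr Quat => /=; ring. Qed.
Lemma quat_addC : commutative quat_add.
Proof. by case=> ? ? ? ? [? ? ? ?]; congr Quat => /=; ring. Qed.
Lemma quat_add0 : left_id quat_zero quat_add.
Proof. by case=> ? ? ? ?; congr Quat => /=; ring. Qed.
Lemma quat_addN : left_inverse quat_zero quat_opp quat_add.
Proof. by case=> ? ? ? ?; congr Quat => /=; ring. Qed.

HB.instance Definition _ :=
  GRing.isZmodule.Build Q quat_addA quat_addC quat_add0 quat_addN.

Lemma quat_mulA : associative quat_mul.
Proof. by case=> ? ? ? ? [? ? ? ?] [? ? ? ?]; congr Quat => /=; ring. Qed.
Lemma quat_mul1q : left_id quat_one quat_mul.
Proof. by case=> ? ? ? ?; congr Quat => /=; ring. Qed.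
Lemma quat_mulq1 : right_id quat_one quat_mul.
Proof. by case=> ? ? ? ?; congr Quat => /=; ring. Qed.
Lemma quat_mulDl : left_distributive quat_mul +%R.
Proof. by case=> ? ? ? ? [? ? ? ?] [? ? ? ?]; congr Quat => /=; ring. Qed.
Lemma quat_mulDr : right_distributive quat_mul +%R.
Proof. by case=> ? ? ? ? [? ? ? ?] [? ? ? ?]; congr Quat => /=; ring. Qed.
Lemma quat_one_neq0 : quat_one != 0.
Proof. by apply/eqP => /(congr1 (@qre _ _ _))/eqP; rewrite oner_eq0. Qed.

HB.instance Definition _ := GRing.Zmodule_isNzRing.Build Q
  quat_mulA quat_mul1q quat_mulq1 quat_mulDl quat_mulDr quat_one_neq0.

Lemma quat_scaleA c d u : quat_scale c (quat_scale d u) = quat_scale (c * d) u.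
Proof. by congr Quat => /=; ring. Qed.
Lemma quat_scale1 : left_id 1 quat_scale.
Proof. by case=> ? ? ? ?; congr Quat => /=; ring. Qed.
Lemma quat_scaleDr : right_distributive quat_scale +%R.
Proof. by move=> c [? ? ? ?] [? ? ? ?]; congr Quat => /=; ring. Qed.
Lemma quat_scaleDl u : {morph quat_scale^~ u : c d / c + d}.
Proof. by move=> c d; congr Quat => /=; ring. Qed.

HB.instance Definition _ := GRing.Zmodule_isLmodule.Build F Q
  quat_scaleA quat_scale1 quat_scaleDr quat_scaleDl.

Lemma quat_scaleAl (c : F) u v : c *: (u * v) = c *: u * v.
Proof. by case: u v => ? ? ? ? [? ? ? ?]; congr Quat => /=; ring. Qed.
HB.instance Definition _ := GRing.Lmodule_isLalgebra.Build F Q quat_scaleAl.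

Lemma quat_scaleAr (c : F) u v : c *: (u * v) = u * (c *: v).
Proof. by case: u v => ? ? ? ? [? ? ? ?]; congr Quat => /=; ring. Qed.
HB.instance Definition _ := GRing.Lalgebra_isAlgebra.Build F Q quat_scaleAr.

Lemma quat_vector_axiom : Vector.axiom 4 Q.
Proof.
exists quat_row; last by exists row_quat; [exact: quat_rowK | exact: row_quatK].
by move=> c u v; apply/rowP => -[[|[|[|[|k]]]] hk]; rewrite // !mxE.
Qed.
HB.instance Definition _ := Lmodule_hasFinDim.Build F Q quat_vector_axiom.

Definition nrd u : F :=
  qre u ^+ 2 - a * qi u ^+ 2 - b * qj u ^+ 2 + a * b * qij u ^+ 2.

Definition qconj u : Q := Quat (qre u) (- qi u) (- qj u) (- qij u).

Lemma mul_qconj u : u * qconj u = (nrd u)%:A.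
Proof. by case: u => x y z w; congr Quat; rewrite /nrd /=; ring. Qed.

Lemma nrdM u v : nrd (u * v) = nrd u * nrd v.
Proof. by case: u v => ? ? ? ? [? ? ? ?]; rewrite /nrd /=; ring. Qed.

Definition quat_split := exists f : {lrmorphism Q -> 'M[F]_2}, bijective f.

End QuatAlgebra.

(* (a, b | K) is (a, b | rat) tensored with K over rat; this is the map
   alpha |-> alpha (x) 1. *)
Definition quat_ratr (K : numFieldType) (a b : rat) (u : quat a b) :
    quat (ratr a : K) (ratr b) :=
  Quat (ratr (qre u)) (ratr (qi u)) (ratr (qj u)) (ratr (qij u)).

Section Orders.
Variables a b : rat.
Local Notation M := (quat a b).

(* An order is a subring that is a lattice: the Z-span of a finite family which
   spans M over rat. *)
Definition is_order (O : set M) : Prop :=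
  [/\ O 1,
      forall x y, O x -> O y -> O (x * y)
    & exists m (s : m.-tuple M),
        (<< s >>%VS = fullv) /\ (O = [set x | inIntSpan s x])].

Definition is_maximal_order (O : set M) : Prop :=
  is_order O /\ forall O', is_order O' -> O `<=` O' -> O' = O.

End Orders.

Section PSL2.
Variable F : fieldType.

Record SL2 : Type := MkSL2 { SL2val :> 'M[F]_2; _ : \det SL2val == 1 }.

HB.instance Definition _ := [isSub for SL2val].
HB.instance Definition _ := [Choice of SL2 by <:].

Implicit Types g h : SL2.

Lemma SL2P g : \det g = 1. Proof. by apply/eqP; case: g. Qed.

Fact SL2_one_subproof : \det (1%:M : 'M[F]_2) == 1.
Proof. by rewrite det1. Qed.
Fact SL2_mul_subproof g h : \det (g *m h) == 1.
Proof. by rewrite det_mulmx !SL2P mulr1. Qed.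
Fact SL2_inv_subproof g : \det (invmx g) == 1.
Proof. by rewrite det_inv SL2P invr1. Qed.
Fact SL2_opp_subproof g : \det (- (g : 'M[F]_2)) == 1.
Proof. by rewrite -scaleN1r detZ SL2P mulr1 sqrrN expr1n. Qed.

Definition SL2_one := MkSL2 SL2_one_subproof.
Definition SL2_mul g h := MkSL2 (SL2_mul_subproof g h).
Definition SL2_inv g := MkSL2 (SL2_inv_subproof g).
Definition SL2_opp g := MkSL2 (SL2_opp_subproof g).

Lemma SL2_unit g : (g : 'M[F]_2) \in unitmx.
Proof. by rewrite unitmxE SL2P unitr1. Qed.

Lemma SL2_mulA : associative SL2_mul.
Proof. by move=> g h k; apply/val_inj; rewrite /= mulmxA. Qed.
Lemma SL2_mul1 : left_id SL2_one SL2_mul.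
Proof. by move=> g; apply/val_inj; rewrite /= mul1mx. Qed.
Lemma SL2_mulr1 : right_id SL2_one SL2_mul.
Proof. by move=> g; apply/val_inj; rewrite /= mulmx1. Qed.
Lemma SL2_mulV : left_inverse SL2_one SL2_inv SL2_mul.
Proof. by move=> g; apply/val_inj; rewrite /= mulVmx ?SL2_unit. Qed.
Lemma SL2_mulrV : right_inverse SL2_one SL2_inv SL2_mul.
Proof. by move=> g; apply/val_inj; rewrite /= mulmxV ?SL2_unit. Qed.

HB.instance Definition _ :=
  isGroup.Build SL2 SL2_mulA SL2_mul1 SL2_mulr1 SL2_mulV SL2_mulrV.

Definition pm_eq g h := (g == h) || (g == SL2_opp h).

Lemma pm_eqE g h : pm_eq g h =
  ((g : 'M[F]_2) == h) || ((g : 'M[F]_2) == - (h : 'M[F]_2)).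
Proof. by []. Qed.

Lemma pm_eq_refl : reflexive pm_eq.
Proof. by move=> g; rewrite /pm_eq eqxx. Qed.
Lemma pm_eq_sym : symmetric pm_eq.
Proof.
move=> g h; rewrite !pm_eqE; congr (_ || _); first exact: eq_sym.
by apply/eqP/eqP => ->; rewrite opprK.
Qed.
Lemma pm_eq_trans : transitive pm_eq.
Proof.
move=> h g k; rewrite !pm_eqE => /orP[]/eqP-> /orP[]/eqP->;
  by rewrite ?opprK eqxx ?orbT.
Qed.

Canonical pm_equiv := EquivRel pm_eq pm_eq_refl pm_eq_sym pm_eq_trans.

Definition PSL2 := {eq_quot pm_equiv}.

HB.instance Definition _ := Choice.on PSL2.
HB.instance Definition _ := EqQuotient.on PSL2.

Definition toPSL2 (g : SL2) : PSL2 := \pi_PSL2 g.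

Lemma toPSL2_eq g h : reflect (g = h :> 'M[F]_2 \/ g = - (h : 'M[F]_2) :> 'M[F]_2)
  (toPSL2 g == toPSL2 h).
Proof.
rewrite /toPSL2 eqmodE /= pm_eqE.
by apply: (iffP orP) => -[] /eqP; [left|right|left|right].
Qed.

Definition PSL2_one : PSL2 := toPSL2 1%g.
Definition PSL2_mul (x y : PSL2) : PSL2 := toPSL2 (repr x * repr y)%g.
Definition PSL2_inv (x : PSL2) : PSL2 := toPSL2 (repr x)^-1%g.

Lemma toPSL2K x : toPSL2 (repr x) = x. Proof. exact: reprK. Qed.

Lemma repr_toPSL2 g : repr (toPSL2 g) = g :> 'M[F]_2
  \/ repr (toPSL2 g) = - (g : 'M[F]_2) :> 'M[F]_2.
Proof. by apply/toPSL2_eq; rewrite toPSL2K. Qed.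

Lemma toPSL2M g h : PSL2_mul (toPSL2 g) (toPSL2 h) = toPSL2 (g * h)%g.
Proof.
apply/eqP/toPSL2_eq => /=.
by case: (repr_toPSL2 g) => ->; case: (repr_toPSL2 h) => ->;
  rewrite ?mulNmx ?mulmxN ?opprK; [left|right|right|left].
Qed.

Lemma PSL2_mulA : associative PSL2_mul.
Proof.
move=> x y z; rewrite -(toPSL2K x) -(toPSL2K y) -(toPSL2K z).
by rewrite !toPSL2M mulgA.
Qed.
Lemma PSL2_mul1 : left_id PSL2_one PSL2_mul.
Proof. by move=> x; rewrite -(toPSL2K x) toPSL2M mul1g. Qed.
Lemma PSL2_mulr1 : right_id PSL2_one PSL2_mul.
Proof. by move=> x; rewrite -(toPSL2K x) toPSL2M mulg1. Qed.
Lemma PSL2_mulV : left_inverse PSL2_one PSL2_inv PSL2_mul.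
Proof. by move=> x; rewrite -[X in PSL2_mul _ X]toPSL2K toPSL2M mulVg. Qed.
Lemma PSL2_mulrV : right_inverse PSL2_one PSL2_inv PSL2_mul.
Proof. by move=> x; rewrite -[X in PSL2_mul X _]toPSL2K toPSL2M mulgV. Qed.

HB.instance Definition _ :=
  isGroup.Build PSL2 PSL2_mulA PSL2_mul1 PSL2_mulr1 PSL2_mulV PSL2_mulrV.

End PSL2.

Section Gaps.
Variable R : realType.
Implicit Types (Gamma : set (PSL2 R)) (gamma : PSL2 R).

Definition hyperbolic gamma : Prop :=
  exists g : SL2 R, toPSL2 g = gamma /\ 2 < `|\tr (g : 'M[R]_2)|.

(* N(gamma) = lambda, for gamma hyperbolic: the lifts of gamma have eigenvalues
   +-lambda and +-lambda^-1, with the same sign. *)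
Definition has_norm gamma (lambda : R) : Prop :=
  1 < lambda /\
  exists (g : SL2 R) (s : bool), toPSL2 g = gamma /\
    char_poly (g : 'M[R]_2) =
      ('X - ((-1) ^+ s * lambda)%:P) * ('X - ((-1) ^+ s * lambda^-1)%:P).

Definition primitive Gamma gamma : Prop :=
  ~ exists (delta : PSL2 R) (k : nat),
      [/\ Gamma delta, (2 <= k)%N & gamma = (delta ^+ k)%g].

Definition norm_set Gamma : set R :=
  [set lambda | exists gamma, [/\ Gamma gamma, hyperbolic gamma,
                                  primitive Gamma gamma & has_norm gamma lambda]].

Definition enumerates_increasingly (x : R^nat) (S : set R) : Prop :=
  (forall n, x n < x n.+1) /\ range x = S.

Definition LG (x : R^nat) : \bar R :=
  limn_einf (fun n => (`|x n.+1 - x n|)%:E).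

(* The enumeration of [norm_set Gamma], when it exists, is unique; its existence
   is part of the definition. *)
Definition bounded_gaps_group Gamma : Prop :=
  exists x : R^nat, enumerates_increasingly x (norm_set Gamma) /\
    (0 < LG x < +oo)%E.

(* phi(O^1) / {+-1}, with phi defined on M (x) R *)
Definition quat_unit_group (a b : rat) (O : set (quat a b))
    (phi : quat (ratr a : R) (ratr b) -> 'M[R]_2) : set (PSL2 R) :=
  [set gamma | exists alpha (g : SL2 R), [/\ O alpha, nrd alpha = 1,
     g = phi (quat_ratr R alpha) :> 'M[R]_2 & toPSL2 g = gamma]].

End Gaps.

(* Main.v *)
(* A hyperbolic element of trace +-t has norm (t + sqrt (t^2 - 4)) / 2, and traces
   of units of reduced norm 1 in an order are integers; so the gaps are at least 1,
   and it remains to find infinitely many pairs of primitive traces at bounded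
   distance.
   Assume a > 0 (else exchange i and j); a is not a square since the algebra does
   not split. Pell's equation in Q(i) gives a unit B = p + q i. Let y be a multiple
   of (1 + b) i - 2 ij, whose square is again a positive nonsquare, and let
   g = r + v y run through the units with r = 1 and v = 0 modulo nrd (B - 1), which
   makes u = (B - 1)^-1 g^-1 (B - 1) integral. Put x = u B g. Then
   tr (x B) - tr x = tr (x (B - 1)) = tr (B (B - 1)) does not depend on g, while
   tr x = tr B + kappa v^2 with kappa <> 0 is unbounded.
   Both x and x B are primitive for large v: if x = +-e^k with k >= 2, then one of
   x - 1, x + 1 is divisible in the order by an integer that is large with tr x.
   But g (B - 1) (x - s) = r X + v Y where X and Y are linearly independent and do
   not depend on g, and r, v are coprime, so the divisors of x - s are bounded. *)

Require Import Defs.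
From HB Require Import structures.
From mathcomp Require Import all_boot all_order all_algebra.
From mathcomp Require Import zify ring lra.
From mathcomp Require Import all_classical all_reals all_analysis.

Set Implicit Arguments.
Unset Strict Implicit.
Unset Printing Implicit Defensive.

Import Order.TTheory GRing.Theory Num.Theory.
Local Open Scope classical_set_scope.
Local Open Scope ring_scope.

(** * Pell's equation *)

Lemma eqz_mod_addmul (x y m : int) :
  (x %% m = y %% m)%Z -> exists k, y = x + k * m.
Proof.
move=> e; exists ((y %/ m)%Z - (x %/ m)%Z).
have := divz_eq y m; have := divz_eq x m; rewrite e.
by move: (x %/ m)%Z (y %/ m)%Z (y %% m)%Z => A B r -> ->; ring.
Qed.

Lemma card_lt_collision (S T : finType) (f : S -> T) :
  (#|T| < #|S|)%N -> exists x y, x != y /\ f x = f y.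
Proof.
move=> lt_TS; have /injectivePn[x [y nxy fxy]] : ~~ injectiveb f.
  by apply/negP => /injectiveP /leq_card; rewrite leqNgt lt_TS.
by exists x, y.
Qed.

(** Pigeonhole: the fractional parts of the [n + 1] multiples of [x] from [0 * x] to [n * x] fall
    into [n] cells of length [1 / n], and the difference of two in one cell works. *)
Lemma dirichlet_approximation (R : realType) (x : R) (n : nat) : (0 < n)%N ->
  exists (p : int) (q : nat), (0 < q <= n)%N /\ `|q%:R * x - p%:~R| < n%:R^-1.
Proof.
case: n => // n _; set N : R := n.+1%:R.
have N0 : 0 < N by rewrite ltr0n.
pose fr (k : nat) : R := k%:R * x - (Num.floor (k%:R * x))%:~R.
have fr_itv k : 0 <= fr k < 1.
  by have := floor_itv (k%:R * x); rewrite /fr intrD; lra.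
pose cell (k : nat) := Num.floor (N * fr k).
have cell_itv k : (0 <= cell k < n.+1%:Z)%R.
  have /andP[f0 f1] := fr_itv k.
  rewrite /cell floor_lt_int floor_ge0 mulr_ge0 ?(ltW N0) //=.
  by rewrite -[ltRHS]mulr1 ltr_pM2l.
pose f (k : 'I_n.+2) : 'I_n.+1 := inord `|cell k|%N.
have [i [j [nij fij]]] : exists i j, i != j /\ f i = f j.
  by apply: card_lt_collision; rewrite !card_ord.
wlog lt_ij : i j nij fij / (i < j)%N.
  move=> H; have [/H|/H|/val_inj/eqP] := ltngtP i j; first exact.
    by apply; rewrite 1?eq_sym.
  by rewrite (negPf nij).
have cij : cell i = cell j.
  have := congr1 val fij; have ci := cell_itv i; have cj := cell_itv j.
  rewrite /= !inordK; lia.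
exists (Num.floor (j%:R * x) - Num.floor (i%:R * x)), (j - i)%N; split.
  by rewrite subn_gt0 lt_ij /= (leq_trans (leq_subr _ _)) // -ltnS ltn_ord.
have -> : (j - i)%:R * x - (Num.floor (j%:R * x) - Num.floor (i%:R * x))%:~R
   = fr j - fr i.
  by rewrite natrB ?(ltnW lt_ij) // intrB /fr; ring.
have := floor_itv (N * fr i); have := floor_itv (N * fr j).
rewrite -!/(cell _) cij !intrD => Hj Hi.
rewrite -(ltr_pM2l N0) mulfV ?gt_eqF // -[X in X * _](gtr0_norm N0) -normrM.
by rewrite ltr_norml mulrBr; lra.
Qed.

Section Pell.
Variables (R : realType) (d : nat).
Hypothesis dN : forall k : nat, (k ^ 2 != d)%N.
Let s : R := Num.sqrt d%:R.
Let s0 : 0 <= s. Proof. exact: sqrtr_ge0. Qed.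
Let s2 : s ^+ 2 = d%:R. Proof. by rewrite sqr_sqrtr. Qed.

Lemma sqrt_nonsquare_irrational (p q : int) : p%:~R = q%:~R * s -> q = 0.
Proof.
move=> /(congr1 (fun z => z ^+ 2)); rewrite exprMn s2 => /eqP.
rewrite pmulrn -!rmorphXn -intrM eqr_int => /eqP e.
apply/eqP/negPn/negP => q0.
have {}e : (`|p| ^ 2 = `|q| ^ 2 * d)%N by lia.
have : (`|q| ^ 2 %| `|p| ^ 2)%N by rewrite e dvdn_mulr.
rewrite dvdn_pexp2r // => /dvdnP[k pk].
have q0' : (0 < `|q| ^ 2)%N by rewrite expn_gt0 absz_gt0 q0.
have /eqP := e; rewrite pk expnMn mulnC eqn_pmul2l // => kd.
by move: (dN k); rewrite kd.
Qed.

Let err (z : int * int) : R := `|z.1%:~R - z.2%:~R * s|.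
Let norm (z : int * int) : int := z.1 ^+ 2 - d%:Z * z.2 ^+ 2.

Let M := (Num.truncn (2 * s + 1)).+1.

(** The norm is the product of the error [p - q s] and its conjugate [p + q s]. With [q <= n] and an
    error below [1 / n] it is at most [2 s + 1], whatever [n] is. *)
Lemma small_norms (e : R) : 0 < e ->
  exists z, [/\ 0 < err z, err z < e & (`|norm z| <= M)%N].
Proof.
move=> e0; set n := (Num.truncn (e^-1)).+1.
have ne : n%:R^-1 <= e.
  by rewrite -[leRHS]invrK lef_pV2 ?posrE ?invr_gt0 // ltW // truncnS_gt.
have [p [q [/andP[q0 qn] pq]]] := @dirichlet_approximation R s n isT.
have n0 : 0 < n%:R :> R by rewrite ltr0n.
have Ez : err (p, q%:Z) = `|q%:R * s - p%:~R| by rewrite /err distrC -pmulrn.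
exists (p, q%:Z); rewrite Ez; split; last 1 first.
- have : `|p%:~R ^+ 2 - d%:R * q%:R ^+ 2 : R| <= 2 * s + 1.
    have -> : p%:~R ^+ 2 - d%:R * q%:R ^+ 2 =
      - (q%:R * s - p%:~R) * (2 * (q%:R * s) - (q%:R * s - p%:~R)).
      by rewrite -s2; ring.
    rewrite normrM normrN.
    have h1 : `|2 * (q%:R * s) - (q%:R * s - p%:~R)| <= n%:R * (2 * s) + 1.
      apply: (le_trans (ler_normB _ _)); apply: lerD.
        rewrite ger0_norm ?mulr_ge0 // mulrCA ler_wpM2r ?mulr_ge0 //.
        by rewrite ler_nat.
      by rewrite (le_trans (ltW pq)) // invf_le1 // ler1n.
    apply: (le_trans (ler_pM _ _ (ltW pq) h1)) => //.
    rewrite mulrDr mulKf ?gt_eqF // mulr1 lerD2l.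
    by rewrite invf_le1 // ler1n.
  have -> : p%:~R ^+ 2 - d%:R * q%:R ^+ 2 = (norm (p, q%:Z))%:~R :> R.
    by rewrite /norm /= intrB intrM !rmorphXn /= -!pmulrn.
  rewrite -intr_norm => h.
  have := le_lt_trans h (truncnS_gt _); rewrite -/M -abszE -!pmulrn ltr_nat.
  exact: ltnW.
- rewrite normr_gt0 subr_eq0; apply/eqP => /esym E.
  have := @sqrt_nonsquare_irrational p q%:Z; rewrite -pmulrn => /(_ E).
  by move=> [q0']; rewrite q0' in q0.
- exact: lt_le_trans pq ne.
Qed.

(** Among enough pairs of bounded norm, two share their norm [m] and their residues modulo [m]; the
    quotient of [p1 + q1 s] by [p2 + q2 s] is then integral of norm 1. *)
Lemma pell : exists u v : int, v != 0 /\ u ^+ 2 - d%:Z * v ^+ 2 = 1.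
Proof.
have [G HG] : {G & forall e, 0 < e ->
    [/\ 0 < err (G e), err (G e) < e & (`|norm (G e)| <= M)%N]}.
  apply: (@choice _ _ (fun e z => 0 < e ->
    [/\ 0 < err z, err z < e & (`|norm z| <= M)%N])) => e.
  (* [(0, 0)] is a dummy value for [e <= 0], where nothing is required. *)
  have [e0|e0] := ltP 0 e; last by exists (0, 0).
  by have [z Hz] := small_norms e0; exists z.
(* Each pair has to beat the error of the previous one, so the errors strictly decrease. *)
pose f n := iter n (G \o err) (G 1).
have f0 n : 0 < err (f n) /\ (`|norm (f n)| <= M)%N.
  by elim: n => [|n [h _]]; [have [] := HG 1 ltr01 | have [] := HG _ h].
have fS n : err (f n.+1) < err (f n) by have [] := HG _ (proj1 (f0 n)).
have flt m n : (m < n)%N -> err (f n) < err (f m).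
  elim: n => // n IH; rewrite ltnS leq_eqVlt => /orP[/eqP-> //|/IH].
  exact: lt_trans.
(* The shift by [M] makes the norm nonnegative, so that its absolute value loses nothing. *)
pose col (z : int * int) : 'I_(M + M).+1 * 'I_M.+1 * 'I_M.+1 :=
  (inord `|(norm z + M%:Z)%R|, inord `|(z.1 %% norm z)%Z|,
   inord `|(z.2 %% norm z)%Z|).
set C := #|{: 'I_(M + M).+1 * 'I_M.+1 * 'I_M.+1}|.
have [i [j [nij cij]]] : exists i j : 'I_C.+1, i != j /\ col (f i) = col (f j).
  by apply: card_lt_collision; rewrite card_ord.
have {nij} eij : err (f i) != err (f j).
  have [/flt|/flt|/val_inj/eqP] := ltngtP i j; last by rewrite (negPf nij).
    by move=> h; rewrite gt_eqF.
  by move=> h; rewrite lt_eqF.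
move: (f0 i) (f0 j) eij cij; case: (f i) (f j) => [p1 q1] [p2 q2].
set m := norm (p1, q1) => -[e1 m1] [e2 m2] eij [] c1 c2 c3.
have nm : norm (p2, q2) = m.
  have := congr1 val c1; rewrite /= !inordK ?nm; lia.
rewrite nm in c2 c3.
have m0 : m != 0.
  apply/negP => /eqP m0; move: e1; rewrite normr_gt0 subr_eq0 => /eqP.
  move: m0; rewrite /m /norm /= => /eqP; rewrite subr_eq0 => /eqP.
  move=> /(congr1 (intr : int -> R)); rewrite intrM !rmorphXn /= -pmulrn -s2.
  move=> E nE; have : (p1%:~R == q1%:~R * s) || (p1%:~R == - (q1%:~R * s)).
    by rewrite -eqf_sqr exprMn mulrC E.
  case/orP => /eqP E'; first exact: nE.
  have E2 : p1%:~R = (- q1)%:~R * s by rewrite intrN mulNr.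
  have /eqP := sqrt_nonsquare_irrational E2; rewrite oppr_eq0 => /eqP q0.
  by apply: nE; rewrite E' q0 mul0r oppr0.
have modlt x : (`|(x %% m)%Z| < M.+1)%N.
  have := modz_ge0 x m0; have := ltz_mod x m0; lia.
have {}c2 : (p1 %% m)%Z = (p2 %% m)%Z.
  have := congr1 val c2; rewrite /= !inordK // => h.
  by rewrite -(gez0_abs (modz_ge0 p1 m0)) -(gez0_abs (modz_ge0 p2 m0)) h.
have {}c3 : (q1 %% m)%Z = (q2 %% m)%Z.
  have := congr1 val c3; rewrite /= !inordK // => h.
  by rewrite -(gez0_abs (modz_ge0 q1 m0)) -(gez0_abs (modz_ge0 q2 m0)) h.
have [k ek] := eqz_mod_addmul c2.
have [l el] := eqz_mod_addmul c3.
(* [m * (u + v s) = (p1 + q1 s) * (p2 - q2 s)]; [hu] and [hv] compare the coefficients. *)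
pose u := 1 + p1 * k - d%:Z * q1 * l; pose v := q1 * k - p1 * l.
have mE : m = p1 ^+ 2 - d%:Z * q1 ^+ 2 by [].
have hu : p1 * p2 - d%:Z * q1 * q2 = u * m.
  transitivity (p1 ^+ 2 - d%:Z * q1 ^+ 2 + (p1 * k - d%:Z * q1 * l) * m).
    by rewrite ek el; ring.
  by rewrite -mE /u; ring.
have hv : q1 * p2 - p1 * q2 = v * m by rewrite /v ek el; ring.
have huv : u ^+ 2 - d%:Z * v ^+ 2 = 1.
  have m20 : m ^+ 2 != 0 by rewrite sqrf_eq0.
  apply: (mulIf m20); rewrite mul1r.
  transitivity ((u * m) ^+ 2 - d%:Z * (v * m) ^+ 2); first by ring.
  transitivity (m * norm (p2, q2)); last by rewrite nm.
  by rewrite -hu -hv mE /norm /=; ring.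
(* If [v = 0] then [u] is 1 or -1 and the two pairs agree up to sign, against their distinct
   errors. *)
exists u, v; split => //; apply/negP => /eqP v0.
move: hu hv huv; rewrite v0 expr0n mulr0 subr0 mul0r => hu hv /eqP.
rewrite sqrf_eq1 => u1.
have hp : p2 = u * p1.
  apply: (mulIf m0); rewrite mE.
  have -> : u * p1 * (p1 ^+ 2 - d%:Z * q1 ^+ 2) = p1 * (u * m) by rewrite mE; ring.
  rewrite -hu; move/eqP: hv; rewrite subr_eq0 => /eqP hv.
  transitivity (p1 * (p1 * p2) - d%:Z * q1 * (q1 * p2)); first by ring.
  by rewrite hv; ring.
have hq : q2 = u * q1.
  apply: (mulIf m0); rewrite mE.
  have -> : u * q1 * (p1 ^+ 2 - d%:Z * q1 ^+ 2) = q1 * (u * m) by rewrite mE; ring.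
  rewrite -hu; move/eqP: hv; rewrite subr_eq0 => /eqP hv.
  transitivity (p1 * (p1 * q2) - d%:Z * q1 * (q1 * q2)); first by ring.
  by rewrite -hv; ring.
move/negP: eij; apply; apply/eqP; rewrite /err /= hp hq.
have -> : (u * p1)%:~R - (u * q1)%:~R * s = u%:~R * (p1%:~R - q1%:~R * s) :> R.
  by rewrite !intrM; ring.
by rewrite normrM -intr_norm; case/orP: u1 => /eqP->; rewrite ?normrN normr1 mul1r.
Qed.

End Pell.

(** * Orders and powers of units *)

Lemma int_mulr_denq (x : rat) (D : int) :
  D%:~R * x \is a Num.int -> (denq x %| D)%Z.
Proof.
move=> /intrP[k Dx]; have : D * numq x = k * denq x.
  apply/eqP; rewrite -(eqr_int rat) !intrM -Dx -mulrA; apply/eqP.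
  by congr (_ * _); rewrite numqE.
have cop : coprimez (denq x) (numq x).
  by rewrite coprimez_sym coprimezE coprime_num_den.
by move=> E; rewrite -(Gauss_dvdzl _ cop) E dvdz_mull.
Qed.

(** For [n / d] in lowest terms, the new numerator [n^2 - 2 d^2] is still prime to [d]. *)
Lemma denq_sqrB2 (x : rat) : denq (x ^+ 2 - 2%:R) = denq x ^+ 2.
Proof.
have d0 : (denq x)%:~R != 0 :> rat by rewrite intr_eq0 denq_neq0.
have -> : x ^+ 2 - 2%:R =
    (numq x ^+ 2 - denq x ^+ 2 *+ 2)%:~R / (denq x ^+ 2)%:~R.
  rewrite intrB mulrBl rmorphXn /= numqE !rmorphXn /= exprMn mulfK ?expf_neq0 //.
  by rewrite rmorphMn /= mulrnAl rmorphXn /= mulfV ?expf_neq0.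
rewrite coprimeq_den ?expf_eq0 ?(negPf (denq_neq0 _)) ?abszX ?normrX ?gtr0_norm //.
rewrite -abszX -coprimezE; apply: coprimezXr.
have /coprimezP[[u v] /= uv] : coprimez (numq x) (denq x).
  by rewrite coprimezE coprime_num_den.
apply/coprimezP; move: (numq x) (denq x) uv => n d uv.
(* Bezout coefficients read off from the square of [u n + v d = 1]. *)
exists (u ^+ 2, 2%:R * u ^+ 2 * d + 2%:R * u * n * v + v ^+ 2 * d) => /=.
by transitivity ((u * n + v * d) ^+ 2); [ring | rewrite uv expr1n].
Qed.

Lemma common_denominator (I : finType) (c : I -> rat) :
  exists2 n : int, 0 < n & forall i, n%:~R * c i \is a Num.int.
Proof.
exists (\prod_i denq (c i)) => [|i]; first by apply: prodr_gt0 => i _.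
rewrite (bigD1 i) //= intrM mulrAC mulrC [_ * c i]mulrC -numqE -intrM.
exact: intr_int.
Qed.

(** * Reduced norm and trace of quaternions *)

Section Quat.
Variables (F : fieldType) (a b : F).
Local Notation Q := (quat a b).
Implicit Types (x y : Q) (c : F).

Lemma qreB x y : qre (x - y) = qre x - qre y. Proof. by []. Qed.
Lemma qreZ c x : qre (c *: x) = c * qre x. Proof. by []. Qed.

Lemma nrd1 : nrd (1 : Q) = 1. Proof. by rewrite /nrd /=; ring. Qed.
Lemma nrdX x n : nrd (x ^+ n) = nrd x ^+ n.
Proof. by elim: n => [|n IH]; rewrite ?nrd1 // !exprS nrdM IH. Qed.
Lemma nrdZ c x : nrd (c *: x) = c ^+ 2 * nrd x.
Proof. by case: x => ? ? ? ?; rewrite /nrd /=; ring. Qed.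
Lemma nrd_subr1 x : nrd (x - 1) = nrd x - 2%:R * qre x + 1.
Proof. by case: x => ? ? ? ?; rewrite /nrd /=; ring. Qed.

Lemma sqr_quat x : x ^+ 2 = (2%:R * qre x) *: x - (nrd x)%:A.
Proof. by case: x => ? ? ? ?; congr Quat; rewrite /nrd /=; ring. Qed.

End Quat.

(** What the proof retains of an order, stated without a generating family. The last field covers
    traces and coordinates alike, as it only asks that [f] respect subtraction. *)
Record lattice_ring (a b : rat) (O : set (quat a b)) : Prop := LatticeRing {
  lr1 : O 1;
  lrB : forall x y, O x -> O y -> O (x - y);
  lrM : forall x y, O x -> O y -> O (x * y);
  lr_multiple : forall x, exists2 n : int, 0 < n & O (x *~ n);
  lr_denominator : forall f : quat a b -> rat, {morph f : x y / x - y} ->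
    exists2 D : int, D != 0 & forall x, O x -> D%:~R * f x \is a Num.int
}.

Section SubtractionMorphism.
Variables (U V : zmodType) (f : U -> V).
Hypothesis fB : {morph f : x y / x - y}.

Lemma morphB0 : f 0 = 0. Proof. by rewrite -(subrr 0) fB subrr. Qed.
Lemma morphBN x : f (- x) = - f x. Proof. by rewrite -sub0r fB morphB0 sub0r. Qed.
Lemma morphBD x y : f (x + y) = f x + f y.
Proof. by rewrite -[y in LHS]opprK fB morphBN opprK. Qed.

Lemma morphB_mulrz x n : f (x *~ n) = f x *~ n.
Proof.
have fn y k : f (y *+ k) = f y *+ k.
  by elim: k => [|k IH]; rewrite ?morphB0 // !mulrS morphBD IH.
by case: n => k; rewrite ?NegzE ?mulrNz ?morphBN -!pmulrn fn.
Qed.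

End SubtractionMorphism.

(** Multiples and denominators come from clearing finitely many denominators: those of the
    coordinates of [x] along the generators, or of the values of [f] at the generators. *)
Lemma lattice_ring_order (a b : rat) (O : set (quat a b)) :
  is_order O -> lattice_ring O.
Proof.
case=> O1 OM [m [s [sf sO]]]; split => //.
- move=> x y; rewrite sO /= => -[c ->] [d ->]; exists [ffun i => c i - d i].
  by rewrite -sumrB; apply: eq_bigr => i _; rewrite ffunE mulrzBr.
- move=> x; have [n n0 Hn] := common_denominator (fun i => coord s i x).
  exists n => //; rewrite sO /=.
  exists [ffun i => numq (n%:~R * coord s i x)].
  have xs : x \in << s >>%VS by rewrite sf memvf.
  rewrite {1}(coord_span xs) mulrz_suml; apply: eq_bigr => i _.
  by rewrite ffunE -!scaler_int numqK ?Hn // scalerA.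
- move=> f fB; have [n n0 Hn] := common_denominator (fun i : 'I_m => f s`_i).
  exists n; first by rewrite gt_eqF.
  move=> x; rewrite sO /= => -[c ->].
  rewrite (big_morph f (morphBD fB) (morphB0 fB)) mulr_sumr; apply: rpred_sum => i _.
  by rewrite (morphB_mulrz fB) mulrzAr rpredMz.
Qed.

Section LatticeRing.
Variables (a b : rat) (O : set (quat a b)).
Hypothesis hO : lattice_ring O.
Local Notation M := (quat a b).
Implicit Types (x y e : M).

Lemma lrN x : O x -> O (- x).
Proof.
by move=> Ox; rewrite -sub0r -(subrr 1); apply: (lrB hO) => //;
  apply: (lrB hO); exact: (lr1 hO).
Qed.
Lemma lrD x y : O x -> O y -> O (x + y).
Proof. by move=> Ox Oy; rewrite -[y]opprK; apply: (lrB hO) => //; exact: lrN. Qed.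
Lemma lrMz x (n : int) : O x -> O (x *~ n).
Proof.
move=> Ox; have H k : O (x *+ k).
  elim: k => [|k IH]; first by rewrite mulr0n -(subrr x); apply: (lrB hO).
  by rewrite mulrS; exact: lrD.
by case: n => k; rewrite ?NegzE ?mulrNz -pmulrn; [|apply: lrN]; exact: H.
Qed.
Lemma lrX x n : O x -> O (x ^+ n).
Proof.
by move=> Ox; elim: n => [|n IH]; [exact: (lr1 hO) | rewrite exprS; exact: (lrM hO)].
Qed.
Lemma lr_sign x (s : bool) : O x -> O ((-1) ^+ s * x).
Proof. by move=> Ox; case: s; rewrite ?mulN1r ?mul1r //; exact: lrN. Qed.

(* Otherwise the denominator of the trace of [x ^+ (2 ^ n)] would grow with [n],
   since this trace is iterated by [t |-> t ^+ 2 - 2]. *)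
Lemma lr_unit_trace_int x : O x -> nrd x = 1 -> 2%:R * qre x \is a Num.int.
Proof.
move=> Ox nx; rewrite Qint_def; apply/negPn/negP => den1.
pose t n := 2%:R * qre (x ^+ (2 ^ n)).
have tS n : t n.+1 = t n ^+ 2 - 2%:R.
  rewrite /t expnSr exprM sqr_quat nrdX nx expr1n qreB !qreZ /=; ring.
have grow n : n%:Z + 1 < denq (t n).
  elim: n => [|n IH]; last by rewrite tS denq_sqrB2; nia.
  rewrite /t expn0 expr1 add0r lt_neqAle eq_sym den1.
  by have := denq_gt0 (2%:R * qre x); lia.
have [D D0 HD] := @lr_denominator _ _ _ hO (fun y => 2%:R * qre y)
  (fun y z => mulrBr _ _ _).
have := int_mulr_denq (HD _ (lrX (2 ^ `|D|) Ox)); rewrite -/(t _) => /dvdzP[k Dk].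
have := grow `|D|%N; rewrite abszE.
have : k != 0 by apply: contraNneq D0 => k0; rewrite Dk k0 mul0r.
have := denq_gt0 (t `|D|%N); move: Dk; move: (denq _) => d; nia.
Qed.

(** In terms of an eigenvalue [l] of [x], [W] is [l^(-n) + ... + l^n], an integer polynomial in
    [s = l + l^-1]. These sums start with [1] and [s + 1] and satisfy [W_(n+2) = s W_(n+1) - W_n],
    hence their growth. *)
Lemma odd_power_sub1 x (s : int) : nrd x = 1 -> 2%:R * qre x = s%:~R ->
  forall n, exists W : int, x ^+ n.*2.+1 - 1 = (x ^+ n * (x - 1)) *~ W /\
    ((0 < n)%N -> 3 <= `|s| -> `|s| - 1 <= `|W|).
Proof.
move=> nx sx; have x2 : x ^+ 2 + 1 = x *~ s.
  by rewrite sqr_quat nx sx scale1r subrK scaler_int.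
(* Two consecutive values are carried along, as the recurrence has order two. *)
suff H n : exists W V : int, [/\ x ^+ n.*2.+1 - 1 = (x ^+ n * (x - 1)) *~ W,
    x ^+ n.+1.*2.+1 - 1 = (x ^+ n.+1 * (x - 1)) *~ V &
    3 <= `|s| -> `|W| <= `|V| /\ `|s| - 1 <= `|V|].
  case=> [|n]; first by exists 1; rewrite expr0 mul1r mulr1z.
  by have [W [V [_ HV sV]]] := H n; exists V; split=> // _ /sV[].
elim: n => [|n [W [V [HW HV sWV]]]].
  exists 1, (s + 1); split; first by rewrite expr0 mul1r mulr1z.
  - rewrite mulrzDr mulr1z expr1 -mulrzAl -x2 mulrBr mulr1 mulrBr mulr1 mulrDl.
    rewrite mul1r -exprSr -expr2.
    move=> {nx sx x2}; move: x (x ^+ 2) (x ^+ 3).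
    by move=> [????] [????] [????]; congr Quat => /=; ring.
  - by move=> h; split; lia.
exists V, (s * V - W); split => //.
- have -> : x ^+ n.+2.*2.+1 - 1 = (x ^+ 2 + 1) * (x ^+ n.+1.*2.+1 - 1)
     - x ^+ 2 * (x ^+ n.*2.+1 - 1).
    have ES k : x ^+ k.+1.*2.+1 = x ^+ 2 * x ^+ k.*2.+1 by rewrite -exprD.
    rewrite !ES !mulrBr !mulr1 mulrDl mul1r.
    move: (x ^+ 2 * x ^+ n.*2.+1) => y; move: y (x ^+ 2) (x ^+ 2 * y).
    by move=> [????] [????] [????]; congr Quat => /=; ring.
  rewrite HW HV x2 !mulrzAr mulrzBr; congr (_ - _).
  + by rewrite mulrzAl mulrA -exprS -mulrzA mulrC.
  + by rewrite mulrA -exprD.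
- by move=> s3; have [h1 h2] := sWV s3; nia.
Qed.

End LatticeRing.

(** * Integer factors of powers and of linear combinations *)

Section Content.
Variables (a b : rat) (O : set (quat a b)).
Hypothesis hO : lattice_ring O.
Local Notation M := (quat a b).
Implicit Types (x y e : M).

(** An even power is a square [z^2], and [z^2 + 1] is [z] times its trace; odd powers are handled by
    [odd_power_sub1]. Either way, a large trace of the power forces a large integer factor [g]. *)
Lemma power_content x (k : nat) (t : bool) : O x -> nrd x = 1 -> (1 < k)%N ->
  exists (s : bool) (g : int) e,
  [/\ O e, (-1) ^+ t * x ^+ k - (-1) ^+ s = e *~ g &
      `|2%:R * qre ((-1) ^+ t * x ^+ k)| <= (`|g| ^+ 2 * (`|g| + 5) + 2)%:~R].
Proof.
move=> Ox nx k1; have [ek|ok] := boolP (odd k); last first.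
- set z := x ^+ k./2; have Oz : O z by exact: lrX.
  have -> : x ^+ k = z ^+ 2 by rewrite -exprM muln2 even_halfK.
  have nz : nrd z = 1 by rewrite nrdX nx expr1n.
  have /intrP[s sz] := lr_unit_trace_int hO Oz nz.
  have z2 : z ^+ 2 = z *~ s - 1 by rewrite sqr_quat nz sz scale1r scaler_int.
  (* With the sign opposite to [t] the difference is [z^2 + 1] up to sign. *)
  exists (~~ t), s, ((-1) ^+ t * z); split; first exact: lr_sign.
    rewrite z2 mulrBr mulr1 -mulrzAr signrN opprK subrK //.
  have -> : `|2%:R * qre ((-1) ^+ t * z ^+ 2)| = `|2%:R * qre (z ^+ 2)|.
    by case: t; rewrite ?mul1r // mulN1r /= mulrN normrN.
  have -> : 2%:R * qre (z ^+ 2) = (s ^+ 2 - 2)%:~R.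
    rewrite sqr_quat nz qreB !qreZ sz intrB rmorphXn /= -sz; ring.
  by rewrite -intr_norm ler_int; have := normr_ge0 s; nia.
- have [m [m0 ->]] : exists m, (0 < m)%N /\ k = m.*2.+1.
    exists k./2; split; last by rewrite -[in LHS](odd_double_half k) ek.
    by case: k k1 ek => [|[|[|]]].
  have /intrP[s sx] := lr_unit_trace_int hO Ox nx.
  have [W [HW sW]] := odd_power_sub1 nx sx m.
  exists t, W, ((-1) ^+ t * (x ^+ m * (x - 1))); split.
  + apply: lr_sign => //; apply: (lrM hO); first exact: lrX.
    by apply: (lrB hO) => //; exact: (lr1 hO).
  + by rewrite -mulrzAr -HW mulrBr mulr1.
  have -> : `|2%:R * qre ((-1) ^+ t * x ^+ m.*2.+1)| = `|2%:R * qre (x ^+ m.*2.+1)|.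
    by case: t; rewrite ?mul1r // mulN1r /= mulrN normrN.
  (* Reduced norms in [HW] give [2 - tr (x^k) = W^2 (2 - tr x)] for [k = 2 m + 1]. *)
  have -> : 2%:R * qre (x ^+ m.*2.+1) = (2 - W ^+ 2 * (2 - s))%:~R.
    have := congr1 (@nrd _ a b) HW; rewrite -scaler_int nrdZ nrdM nrdX nx expr1n mul1r.
    rewrite !nrd_subr1 nrdX nx expr1n sx.
    rewrite intrB intrM rmorphXn intrB => H; lra.
  rewrite -intr_norm ler_int; have W0 := normr_ge0 W.
  rewrite -[W ^+ 2]real_normK ?num_real //.
  (* The constant 3 also covers [|s| < 3], where [sW] gives nothing. *)
  have sW' : `|s| <= `|W| + 3 by have [/(sW m0)|] := leP 3 `|s|; lia.
  have : `|2 - s| <= `|W| + 5 by lia.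
  move: (`|W|) W0 => w w0; nia.
Qed.

(** Reading coordinates along [X] and [Y], [g] divides [D0 * r] and [D1 * v]; by [r^2 - d v^2 = 1]
    it then divides [D0 * D1]. *)
Lemma combination_content (X Y : M) : X \notin <[Y]>%VS -> Y != 0 ->
  exists2 D : int, D != 0 & forall (r v d g : int) e, O e ->
    r ^+ 2 - d * v ^+ 2 = 1 -> X *~ r + Y *~ v = e *~ g -> (g %| D)%Z.
Proof.
move=> XY Y0; pose s := [tuple X; Y].
have fs : free s by rewrite /s /= free_cons span_seq1 XY seq1_free.
have morphc (i : 'I_2) : {morph coord s i : x y / x - y}.
  by move=> x y; rewrite linearB.
have cX (i : 'I_2) : coord s i X = (i == 0)%:R.
  by rewrite eq_sym -(coord_free _ _ fs).
have cY (i : 'I_2) : coord s i Y = (i == 1)%:R.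
  by rewrite eq_sym -(coord_free _ _ fs).
have [D0 D00 H0] := lr_denominator hO (morphc 0).
have [D1 D10 H1] := lr_denominator hO (morphc 1).
exists (D0 * D1); first by rewrite mulf_neq0.
move=> r v d g e Oe rv E.
have Er : coord s 0 e *~ g = r%:~R.
  by rewrite -(morphB_mulrz (morphc 0)) -E linearD /= !(morphB_mulrz (morphc 0))
    cX cY /= mul0rz addr0.
have Ev : coord s 1 e *~ g = v%:~R.
  by rewrite -(morphB_mulrz (morphc 1)) -E linearD /= !(morphB_mulrz (morphc 1))
    cX cY /= mul0rz add0r.
have /intrP[k0 Hk0] := H0 _ Oe; have /intrP[k1 Hk1] := H1 _ Oe.
have gr : D0 * r = k0 * g.
  by apply/eqP; rewrite -(eqr_int rat) !intrM -Hk0 -Er -mulrA mulrzr.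
have gv : D1 * v = k1 * g.
  by apply/eqP; rewrite -(eqr_int rat) !intrM -Hk1 -Ev -mulrA mulrzr.
apply/dvdzP; exists (k0 * r * D1 - d * k1 * v * D0).
transitivity (D0 * D1 * (r ^+ 2 - d * v ^+ 2)); first by rewrite rv mulr1.
transitivity (D0 * r * (r * D1) - d * (D1 * v) * (v * D0)); first by ring.
by rewrite gr gv; ring.
Qed.

(* If [w * (x - 1)] and [w * (x + 1)] are integral combinations, with bounded
   content, of fixed independent elements, then neither [x - 1] nor [x + 1] has
   a large integral factor; but one of them does when [x] is a proper power. *)
Lemma large_trace_non_power (X Y : bool -> M) :
  (forall s, X s \notin <[Y s]>%VS) -> (forall s, Y s != 0) ->
  exists F : rat, forall (w x : M) (r v d : int), O w ->
    r ^+ 2 - d * v ^+ 2 = 1 ->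
    (forall s : bool, w * (x - (-1) ^+ s) = X s *~ r + Y s *~ v) ->
    F < `|2%:R * qre x| ->
  forall (y : M) (k : nat) (t : bool), O y -> nrd y = 1 -> (1 < k)%N ->
    x != (-1) ^+ t * y ^+ k.
Proof.
move=> XY Y0.
have [D0 D00 H0] := combination_content (XY false) (Y0 false).
have [D1 D10 H1] := combination_content (XY true) (Y0 true).
(* The bound of [power_content], taken at the largest possible factor [D]. *)
set D := `|D0 * D1|; exists (D ^+ 2 * (D + 5) + 2)%:~R.
move=> w x r v d Ow rv Hx Fx y k t Oy ny k1; apply/eqP => xy.
have [s [g [e [Oe Ee bnd]]]] := power_content t Oy ny k1.
have gD : (g %| D0 * D1)%Z.
  have E : X s *~ r + Y s *~ v = (w * e) *~ g by rewrite -Hx xy Ee mulrzAr.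
  have Owe : O (w * e) by exact: (lrM hO).
  case: s {Ee} E => E; first by rewrite dvdz_mull // (H1 _ _ _ _ _ Owe rv E).
  by rewrite dvdz_mulr // (H0 _ _ _ _ _ Owe rv E).
have {}gD : `|g| <= D.
  rewrite /D; have /dvdzP[c cE] := gD.
  have : D0 * D1 != 0 by rewrite mulf_neq0.
  rewrite cE mulf_eq0 negb_or normrM => /andP[c0 _].
  by rewrite ler_peMl // -gtz0_ge1 normr_gt0.
rewrite -xy in bnd.
suff H : `|g| ^+ 2 * (`|g| + 5) + 2 <= D ^+ 2 * (D + 5) + 2.
  rewrite -(ler_int rat) in H.
  by have := lt_le_trans Fx (le_trans bnd H); rewrite ltxx.
have := normr_ge0 g; move: `|g| D gD {Fx bnd} => h D' hD h0.
by rewrite lerD2r ler_pM ?exprn_ge0 ?addr_ge0 ?lerD2r // lerXn2r ?nnegrE // (le_trans h0).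
Qed.

End Content.

(** * The family of units *)

Lemma nonsquare_mul_sqr (d n : nat) : (0 < n)%N ->
  (forall k : nat, (k ^ 2 != d)%N) -> forall k : nat, (k ^ 2 != d * n ^ 2)%N.
Proof.
move=> n0 dN k; apply/negP => /eqP E.
have : (n ^ 2 %| k ^ 2)%N by rewrite E dvdn_mull.
rewrite dvdn_pexp2r // => /dvdnP[l kl]; move: E; rewrite kl expnMn => /eqP.
by rewrite eqn_pmul2r ?expn_gt0 ?n0 // (negPf (dN l)).
Qed.

(** Take a Pell unit [u + v sqrt (d n^2)] with [n = |N| (K + 1)] and square it: [r = 2 u^2 - 1]
    becomes 1 modulo [N], and the factor [K + 1] makes the second coordinate large. *)
Lemma pell_congruence (R : realType) (d : nat) (N : int) (K : nat) :
  (forall k : nat, (k ^ 2 != d)%N) -> N != 0 ->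
  exists r v w z : int, [/\ r ^+ 2 - d%:Z * v ^+ 2 = 1, v = N * w,
    r = 1 + N * z & K%:Z <= `|v|].
Proof.
move=> dN N0; set n := (`|N| * K.+1)%N.
have n0 : (0 < n)%N by rewrite muln_gt0 absz_gt0 N0.
have [u [v [v0]]] := pell R (nonsquare_mul_sqr n0 dN).
have -> : (d * n ^ 2)%N%:Z = d%:Z * (N * K.+1%:Z) ^+ 2.
  rewrite -mulnn /n !PoszM abszE exprMn -[N ^+ 2]real_normK ?num_real //.
  by rewrite -PoszM; ring.
move=> uv; have u2 : u ^+ 2 = 1 + d%:Z * (N * K.+1%:Z) ^+ 2 * v ^+ 2 by lia.
have u0 : u != 0.
  apply/eqP => u0; move: u2; rewrite u0 expr0n /=.
  have := sqr_ge0 (N * K.+1%:Z); have := sqr_ge0 v; nia.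
have [k kE] : exists k : int, k = K.+1%:Z by exists K.+1.
rewrite -kE in u2 *.
exists (2 * u ^+ 2 - 1), (N * (2 * u * v * k)), (2 * u * v * k),
  (2 * d%:Z * N * k ^+ 2 * v ^+ 2); split => //.
- transitivity (1 + 4 * u ^+ 2 *
    (u ^+ 2 - (1 + d%:Z * (N * k) ^+ 2 * v ^+ 2))); first by ring.
  by rewrite {2}u2; ring.
- by rewrite u2; ring.
- rewrite !normrM; have := normr_gt0 N; have := normr_gt0 u; have := normr_gt0 v.
  rewrite N0 u0 v0 => hv hu hN.
  have h1 : 1 <= `|N| * `|u| * `|v| by rewrite -gtz0_ge1 !mulr_gt0.
  have -> : `|N| * (`|2| * `|u| * `|v| * `|k|) =
     2 * `|k| * (`|N| * `|u| * `|v|) 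
    by have -> : `|2 : int| = 2 by []; ring.
  have : 0 < `|k| - K%:Z by rewrite kE; lia.
  move: (_ * `|v|) (`|k|) h1 => w k' h1; nia.
Qed.

(** The arithmetic counterpart of [norm_set]: [2 < t] is hyperbolicity, and the sign in the last
    condition accounts for the quotient by plus or minus 1. *)
Definition primitive_traces (a b : rat) (O : set (quat a b)) : set nat :=
  [set t | (2 < t)%N /\ exists x, [/\ O x, nrd x = 1, `|2%:R * qre x| = t%:R &
    forall y (k : nat) (s : bool), O y -> nrd y = 1 -> (1 < k)%N ->
      x != (-1) ^+ s * y ^+ k]].

(** Once [|y|] dominates, [x + y] and [x + y + c] both have the sign of [y], which decides whose
    absolute value is larger. *)
Lemma large_shift (h x y c : rat) : 0 <= h -> 0 <= x -> 0 <= c ->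
  h + x + c < `|y| -> [/\ h < `|x + y|, h < `|x + y + c| &
    `|x + y + c| = `|x + y| + c \/ `|x + y| = `|x + y + c| + c].
Proof.
move=> h0 x0 c0; have [y0|y0] := leP 0 y.
  rewrite (ger0_norm y0) => hy; rewrite (ger0_norm (_ : 0 <= x + y)); try lra.
  rewrite (ger0_norm (_ : 0 <= x + y + c)); try lra.
  by split; [lra | lra | left].
rewrite (ltr0_norm y0) => hy; rewrite (ltr0_norm (_ : x + y < 0)); try lra.
rewrite (ltr0_norm (_ : x + y + c < 0)); try lra.
by split; [lra | lra | right; ring].
Qed.

Lemma common_bound (f g : rat) (k : nat) :
  exists h : rat, [/\ f <= h, g <= h, k%:R <= h & 2%:R <= h].
Proof.
exists (`|f| + `|g| + k%:R + 2%:R); have := ler_norm f; have := ler_norm g.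
have := normr_ge0 f; have := normr_ge0 g; have := ler0n rat k.
by move: (k%:R : rat) => l *; split; lra.
Qed.

Section Multiple.
Variables (a b : rat) (O : set (quat a b)).
Hypothesis hO : lattice_ring O.

(** Meant for [x] with square [q]: the multiple of [x] lies in [O] and has square [d], so solutions
    of Pell's equation for [d] give units in [O]. *)
Lemma nonsquare_multiple (x : quat a b) (q : rat) : 0 < q ->
  (forall c : rat, c ^+ 2 != q) ->
  exists (m : int) (d : nat), [/\ 0 < m, O (x *~ m), d%:R = q * m%:~R ^+ 2 &
    forall k : nat, (k ^ 2 != d)%N].
Proof.
move=> q0 qN; have [n n0 On] := lr_multiple hO x.
pose m := n * denq q; have m0 : 0 < m by rewrite mulr_gt0 // denq_gt0.
have E : q * m%:~R ^+ 2 = (numq q * denq q * n ^+ 2)%:~R.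
  by rewrite /m !intrM numqE; ring.
have : 0 <= numq q * denq q * n ^+ 2.
  by rewrite !mulr_ge0 ?sqr_ge0 ?numq_ge0 ?(ltW q0) // ltW ?denq_gt0.
move: (numq q * denq q * n ^+ 2) E => [d|//] E _.
exists m, d; split=> //; first by rewrite /m mulrzA; exact: lrMz.
move=> k; apply/negP => /eqP kd; have := qN (k%:R / m%:~R); rewrite expr_div_n.
have m0' : m%:~R ^+ 2 != 0 :> rat by rewrite sqrf_eq0 intr_eq0 gt_eqF.
by rewrite -natrX kd pmulrn -E mulfK // eqxx.
Qed.

Lemma notin_line (x y : quat a b) : qj x = 0 -> qij x = 0 -> qi x != 0 ->
  (qj y != 0) || (qij y != 0) -> (x \notin <[y]>%VS) && (y != 0).
Proof.
move=> xj xij xi yy; apply/andP; split; last first.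
  by apply: contraTneq yy => ->; rewrite !eqxx.
apply/negP => /vlineP[k xk]; move: xj xij xi; rewrite xk /=.
move=> /eqP; rewrite mulf_eq0 => /orP[/eqP->|/eqP yj]; first by rewrite !mul0r eqxx.
move=> /eqP; rewrite mulf_eq0 => /orP[/eqP->|/eqP yij]; first by rewrite !mul0r eqxx.
by move: yy; rewrite yj yij !eqxx.
Qed.

End Multiple.

(** * Conjugated units and their traces *)

Section Family.
Variables (a b p q y1 y3 : rat).
Hypothesis q0 : q != 0.
Hypothesis hB : p ^+ 2 - a * q ^+ 2 = 1.
Local Notation M := (quat a b).

(** Solving the norm equation of [B] for [a] turns identities modulo [hB] into identities of
    rational functions, which [field] decides. *)
Let aE : a = (p ^+ 2 - 1) / q ^+ 2. Proof. by rewrite -hB; field. Qed.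

Let B : M := Quat p q 0 0.
Let y : M := Quat 0 y1 0 y3.
Let D := a * y1 ^+ 2 - a * b * y3 ^+ 2.

(* This is [(B - 1)^-1 * (r - v y) * (B - 1)]. *)
Definition twist (r v : rat) : M :=
  Quat r (- (v * y1)) (- (a * q * v * y3)) (p * v * y3).

(** [2 - 2 p] is the norm of [B - 1], so the congruences on [r] and [v] cancel the denominator of
    [(B - 1)^-1] and leave the conjugate of [B - 1]. *)
Lemma twist_integral z w : twist (1 + (2%:R - 2%:R * p) * z) ((2%:R - 2%:R * p) * w) =
  1 + (Quat p (- q) 0 0 - 1) * (z%:A - w *: y) * (B - 1).
Proof. by congr Quat => /=; rewrite aE; field. Qed.

Lemma nrd_twist r v : nrd (twist r v) = r ^+ 2 - D * v ^+ 2.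
Proof. by rewrite /nrd /D /= aE; field. Qed.

Lemma mul_twist r v : r ^+ 2 - D * v ^+ 2 = 1 ->
  (r%:A + v *: y) * (B - 1) * twist r v = B - 1.
Proof.
move=> rv; have E : (B - 1) * twist r v = (r%:A - v *: y) * (B - 1).
  by congr Quat => /=; rewrite aE; field.
have N : (r%:A + v *: y) * (r%:A - v *: y) = 1 :> M.
  by rewrite -[1 in RHS]scale1r -rv /D; congr Quat => /=; ring.
by rewrite -mulrA E mulrA N mul1r.
Qed.

Lemma qre_twist r v : r ^+ 2 - D * v ^+ 2 = 1 ->
  qre (twist r v * B * (r%:A + v *: y)) =
    p - a * b * y3 ^+ 2 * (p + 1) * (2%:R * p - 1) * v ^+ 2.
Proof.
(* Multiplying [p] by [1 = r^2 - D v^2] makes both sides homogeneous in [r] and [v]. *)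
move=> rv; transitivity (p * (r ^+ 2 - D * v ^+ 2) -
  a * b * y3 ^+ 2 * (p + 1) * (2%:R * p - 1) * v ^+ 2); last by rewrite rv mulr1.
by rewrite /D /= aE; field.
Qed.

(** With [u] the twist and [g = r + v y], cyclicity of the trace and [mul_twist] give [tr (u B g (B
    - 1)) = tr (B g (B - 1) u) = tr (B (B - 1))], independent of [g]. *)
Lemma qre_twist_mul r v : r ^+ 2 - D * v ^+ 2 = 1 ->
  qre (twist r v * B * (r%:A + v *: y) * B) =
    qre (twist r v * B * (r%:A + v *: y)) + (p - 1) * (2%:R * p + 1).
Proof.
move=> rv; transitivity (qre (twist r v * B * (r%:A + v *: y)) +
  (p - 1) * (2%:R * p + 1) * (r ^+ 2 - D * v ^+ 2)); last by rewrite rv mulr1.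
by rewrite /D /= aE; field.
Qed.

(** By [mul_twist] the product is [(B - 1) B g - (-1)^s g (B - 1)], which is linear in [g], hence in
    [r] and [v]. *)
Lemma mul_twist_sub r v (s : bool) : r ^+ 2 - D * v ^+ 2 = 1 ->
  let g := r%:A + v *: y in
  g * (B - 1) * (twist r v * B * g - (-1) ^+ s) =
    r *: ((B - 1) * B - (-1) ^+ s * (B - 1)) +
    v *: ((B - 1) * B * y - (-1) ^+ s * (y * (B - 1))).
Proof.
move=> rv /=; rewrite mulrBr (commr_sign (_ * (B - 1)) s) !mulrA mul_twist //.
move: (B - 1) => c; rewrite !mulrDr !mulrDl -!scalerAr -!scalerAl !mulr1.
by rewrite !scalerBr opprD addrACA.
Qed.

Lemma mul_twist_mul_sub r v (s : bool) : r ^+ 2 - D * v ^+ 2 = 1 ->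
  let g := r%:A + v *: y in
  g * (B - 1) * (twist r v * B * g * B - (-1) ^+ s) =
    r *: ((B - 1) * B * B - (-1) ^+ s * (B - 1)) +
    v *: ((B - 1) * B * y * B - (-1) ^+ s * (y * (B - 1))).
Proof.
move=> rv /=; rewrite mulrBr (commr_sign (_ * (B - 1)) s) !mulrA mul_twist //.
move: (B - 1) => c; rewrite !mulrDr !mulrDl -!scalerAr -!scalerAl !mulr1.
by rewrite !scalerBr opprD addrACA.
Qed.

End Family.

(** * Linear independence of the fixed coefficients *)

Section Independence.
Variables (a b p q y1 y3 : rat).
Hypotheses (a0 : a != 0) (q0 : q != 0) (y30 : y3 != 0) (p2 : 2%:R <= p).
Hypothesis hB : p ^+ 2 - a * q ^+ 2 = 1.
Local Notation M := (quat a b).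
Let B : M := Quat p q 0 0.
Let y : M := Quat 0 y1 0 y3.
Let aE : a = (p ^+ 2 - 1) / q ^+ 2. Proof. by rewrite -hB; field. Qed.

(** The first element lies in [Q(i)] outside [Q], while [Y] has a nonzero [ij] coordinate. *)
Lemma twist_independent (s : bool) :
  let Y := (B - 1) * B * y - (-1) ^+ s * (y * (B - 1)) in
  ((B - 1) * B - (-1) ^+ s * (B - 1) \notin <[Y]>%VS) && (Y != 0).
Proof.
have p2' := p2.
have h1 : p - 1 != 0 by apply: lt0r_neq0; lra.
have [h2 h3] : 2%:R * p + 1 - (-1) ^+ s != 0 /\ 2%:R * p - 1 - (-1) ^+ s != 0.
  by split; apply: lt0r_neq0; case: s; rewrite /= ?expr1 ?expr0; lra.
apply: notin_line; first by move=> {h2 h3}; case: s => /=; ring.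
- by move=> {h2 h3}; case: s => /=; ring.
- have -> : qi ((B - 1) * B - (-1) ^+ s * (B - 1)) = q * (2%:R * p - 1 - (-1) ^+ s).
    by move=> {h2 h3}; case: s => /=; ring.
  by rewrite mulf_neq0.
- apply/orP; right.
  have -> : qij ((B - 1) * B * y - (-1) ^+ s * (y * (B - 1))) =
      y3 * (p - 1) * (2%:R * p + 1 - (-1) ^+ s).
    by move=> {h2 h3}; case: s => /=; rewrite aE; field.
  by rewrite !mulf_neq0.
Qed.

(** As [ij] conjugates [B] and [B] has norm 1, the part of [Y] outside [Q(i)] is
    [y3 ((B - 1) - (-1)^s (B^-1 - 1)) ij]: a multiple of [j] or of [ij] according to [s]. *)
Lemma twist_mul_independent (s : bool) :
  let Y := (B - 1) * B * y * B - (-1) ^+ s * (y * (B - 1)) in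
  ((B - 1) * B * B - (-1) ^+ s * (B - 1) \notin <[Y]>%VS) && (Y != 0).
Proof.
have p2' := p2.
have h1 : p - 1 != 0 by apply: lt0r_neq0; lra.
have h3 : 4%:R * p ^+ 2 - 2%:R * p - 1 - (-1) ^+ s != 0.
  by apply: lt0r_neq0; case: s; rewrite /= ?expr1 ?expr0; nra.
apply: notin_line; first by move=> {h3}; case: s => /=; ring.
- by move=> {h3}; case: s => /=; ring.
- have -> : qi ((B - 1) * B * B - (-1) ^+ s * (B - 1)) =
      q * (4%:R * p ^+ 2 - 2%:R * p - 1 - (-1) ^+ s).
    by move=> {h3}; case: s => /=; rewrite aE; field.
  by rewrite mulf_neq0.
- apply/orP; move=> {h3}; case: s; [right | left].
  + have -> : qij ((B - 1) * B * y * B - (-1) ^+ true * (y * (B - 1))) =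
      y3 * (2%:R * (p - 1)) by rewrite /= aE; field.
    by rewrite !mulf_neq0.
  + have -> : qj ((B - 1) * B * y * B - (-1) ^+ false * (y * (B - 1))) =
      2%:R * (q * a * y3) by rewrite /= aE; field.
    by rewrite !mulf_neq0.
Qed.

End Independence.

(** * Close pairs of primitive traces *)

Lemma close_primitive_traces_nonsquare (R : realType) (a b : rat)
    (O : set (quat a b)) : lattice_ring O -> 0 < a ->
  (forall c : rat, c ^+ 2 != a) -> b != 0 -> b != 1 ->
  exists c : nat, forall K : nat, exists t t' : nat,
    [/\ primitive_traces O t, primitive_traces O t' &
        [&& K <= t, t < t' & t' <= t + c]%N].
Proof.
move=> hO a0 aN b0 b1.
have a0' : a != 0 by rewrite gt_eqF.
have [m [d [m0 Oim dm dN]]] := nonsquare_multiple hO (Quat 0 1 0 0) a0 aN.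
have [P [V [V0 PV]]] := pell R dN.
(* Replacing [P] by [|P|] keeps the norm and makes [p] positive, in fact at least 2 as [V] is
   nonzero. *)
pose p : rat := `|P|%:~R; pose q : rat := V%:~R * m%:~R.
have q0 : q != 0 by rewrite mulf_neq0 // intr_eq0 // gt_eqF.
have hB : p ^+ 2 - a * q ^+ 2 = 1.
  have := congr1 (intr : int -> rat) PV; rewrite intrB intrM -pmulrn dm => PVq.
  rewrite -[RHS]PVq.
  rewrite /p /q intr_norm real_normK ?num_real // !rmorphXn /=; congr (_ - _).
  by ring.
have P2 : 2 <= `|P|.
  have d1 : (0 < d)%N by have := dN 0; rewrite lt0n eq_sym.
  have V1 : 0 < V ^+ 2 by rewrite exprn_even_gt0.
  have : P ^+ 2 = 1 + d%:Z * V ^+ 2 by lia.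
  rewrite -[P ^+ 2]real_normK ?num_real //.
  have := normr_ge0 P; move: `|P| (V ^+ 2) V1 => x w w0; nia.
have p2 : 2%:R <= p by rewrite /p pmulrn ler_int.
pose B : quat a b := Quat p q 0 0.
have OB : O B.
  have -> : B = 1 *~ `|P| + (Quat 0 1 0 0 *~ m) *~ V.
    by rewrite -!scaler_int; congr Quat; rewrite /= /q; ring.
  by apply: lrD => //; apply: lrMz => //; exact: (lr1 hO).
have OBc : O (Quat p (- q) 0 0).
  have -> : Quat p (- q) 0 0 = 1 *~ `|P| - (Quat 0 1 0 0 *~ m) *~ V :> quat a b.
    by rewrite -!scaler_int; congr Quat; rewrite /= /q; ring.
  by apply: (lrB hO) => //; apply: lrMz => //; exact: (lr1 hO).
have b1' : 1 - b != 0 by rewrite subr_eq0 eq_sym.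
(* [a (1 - b)^2] is the square of [(1 + b) i - 2 ij]; it is a positive nonsquare because [a] is one
   and [b] is not 1. *)
have e0 : 0 < a * (1 - b) ^+ 2 by rewrite mulr_gt0 // exprn_even_gt0.
have eN (c : rat) : c ^+ 2 != a * (1 - b) ^+ 2.
  apply/negP => /eqP E; have := aN (c / (1 - b)).
  by rewrite expr_div_n E mulfK ?eqxx // sqrf_eq0.
have [l [f [l0 Oyl fl fN]]] :=
  nonsquare_multiple hO (Quat 0 (1 + b) 0 (- 2%:R)) e0 eN.
pose y1 : rat := (1 + b) * l%:~R; pose y3 : rat := - 2%:R * l%:~R.
pose y : quat a b := Quat 0 y1 0 y3.
have Oy : O y.
  suff -> : y = Quat 0 (1 + b) 0 (- 2%:R) *~ l by [].
  by rewrite -scaler_int; congr Quat; rewrite /= /y1 /y3; ring.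
have y30 : y3 != 0 by rewrite mulf_neq0 // intr_eq0 gt_eqF.
have fE : f%:R = a * y1 ^+ 2 - a * b * y3 ^+ 2 by rewrite fl /y1 /y3; ring.
(* [N] is [nrd (B - 1)], the modulus in [twist_integral]. *)
pose N : int := 2 - 2 * `|P|.
have N0 : N != 0 by rewrite /N; move: `|P| P2 => x; lia.
have NE : N%:~R = 2%:R - 2%:R * p by rewrite /N /p intrB intrM.
pose X1 (s : bool) := (B - 1) * B - (-1) ^+ s * (B - 1).
pose Y1 (s : bool) := (B - 1) * B * y - (-1) ^+ s * (y * (B - 1)).
pose X2 (s : bool) := (B - 1) * B * B - (-1) ^+ s * (B - 1).
pose Y2 (s : bool) := (B - 1) * B * y * B - (-1) ^+ s * (y * (B - 1)).
have iX1 s : X1 s \notin <[Y1 s]>%VS.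
  by have /andP[] := twist_independent b y1 q0 y30 p2 hB s.
have iY1 s : Y1 s != 0 by have /andP[] := twist_independent b y1 q0 y30 p2 hB s.
have iX2 s : X2 s \notin <[Y2 s]>%VS.
  by have /andP[] := twist_mul_independent b y1 a0' q0 y30 p2 hB s.
have iY2 s : Y2 s != 0.
  by have /andP[] := twist_mul_independent b y1 a0' q0 y30 p2 hB s.
have [F1 HF1] := large_trace_non_power hO iX1 iY1.
have [F2 HF2] := large_trace_non_power hO iX2 iY2.
pose c := 2%:R * ((p - 1) * (2%:R * p + 1)).
have c0 : 0 < c by rewrite /c !mulr_gt0 //; move: (p) p2 => x; lra.
(* The coefficient of [v^2] in the trace of [x]. *)
pose kap := - (2%:R * (a * b * y3 ^+ 2 * (p + 1) * (2%:R * p - 1))).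
have kap0 : kap != 0.
  have [h1 h2] : p + 1 != 0 /\ 2%:R * p - 1 != 0.
    by split; apply: lt0r_neq0; move: (p) p2 => x; lra.
  have h3 : y3 ^+ 2 != 0 by rewrite expf_neq0.
  by rewrite oppr_eq0; apply: mulf_neq0 => //; do 4!apply: mulf_neq0 => //.
pose C : int := 2 * ((`|P| - 1) * (2 * `|P| + 1)).
exists `|C|%N => K.
have [H [HF1' HF2' HK H2]] := common_bound F1 F2 K.
have H0 : 0 <= H by exact: le_trans H2.
pose G : rat := H + 2%:R * p + c.
have [r [v [w [z [rv vN rN Gv]]]]] :=
  pell_congruence R (Num.truncn (G / `|kap|)).+1 fN N0.
have rvq : r%:~R ^+ 2 - (a * y1 ^+ 2 - a * b * y3 ^+ 2) * v%:~R ^+ 2 = 1 :> rat.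
  by rewrite -fE pmulrn -!rmorphXn /= -intrM -intrB rv.
(* [|v|] exceeds [G / |kap|] and is at least 1, so [v^2 >= |v|] suffices. *)
have kG : G < `|kap| * v%:~R ^+ 2.
  rewrite mulrC -ltr_pdivrMr ?normr_gt0 //.
  apply: lt_le_trans (truncnS_gt _) _.
  rewrite -[leRHS]real_normK ?num_real // -intr_norm pmulrn -rmorphXn ler_int.
  by rewrite expr2 (le_trans Gv) // ler_peMl // (le_trans _ Gv).
pose u : quat a b := twist a b p q y1 y3 r%:~R v%:~R.
pose g : quat a b := r%:~R%:A + v%:~R *: y.
have Og : O g.
  by rewrite /g !scaler_int; apply: lrD => //; apply: lrMz => //; exact: (lr1 hO).
have OB1 : O (B - 1) by apply: (lrB hO) => //; exact: (lr1 hO).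
have Ou : O u.
  rewrite /u rN vN intrD !intrM NE (twist_integral b y1 y3 q0 hB) -/y -/B !scaler_int.
  apply: lrD => //; first exact: (lr1 hO).
  apply: (lrM hO) => //; apply: (lrM hO).
    by apply: (lrB hO) => //; exact: (lr1 hO).
  by apply: (lrB hO) => //; apply: lrMz => //; exact: (lr1 hO).
have gBu : g * (B - 1) * u = B - 1 := mul_twist q0 hB rvq.
have nB : nrd B = 1 by rewrite /nrd /= -[RHS]hB; ring.
have ng : nrd g = 1 by rewrite /nrd /= -[RHS]rvq; ring.
have nu : nrd u = 1 by rewrite /u (nrd_twist b y1 y3 q0 hB) rvq.
pose x := u * B * g; pose x' := x * B.
have Ox : O x by do 2!apply: (lrM hO) => //.
have Ox' : O x' by exact: (lrM hO).
have nx : nrd x = 1 by rewrite !nrdM nu nB ng !mulr1.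
have nx' : nrd x' = 1 by rewrite nrdM nx nB mulr1.
have tx : 2%:R * qre x = 2%:R * p + kap * v%:~R ^+ 2.
  by rewrite (qre_twist q0 hB rvq) /kap; ring.
have tx' : 2%:R * qre x' = 2%:R * qre x + c.
  by rewrite (qre_twist_mul q0 hB rvq) /c mulrDr.
have Ogb : O (g * (B - 1)) by exact: (lrM hO).
have Hx (s : bool) : g * (B - 1) * (x - (-1) ^+ s) = X1 s *~ r + Y1 s *~ v.
  by rewrite (mul_twist_sub q0 hB s rvq) !scaler_int.
have Hx' (s : bool) : g * (B - 1) * (x' - (-1) ^+ s) = X2 s *~ r + Y2 s *~ v.
  by rewrite (mul_twist_mul_sub q0 hB s rvq) !scaler_int.
have := @large_shift H (2%:R * p) (kap * v%:~R ^+ 2) c.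
rewrite normrM (ger0_norm (sqr_ge0 v%:~R)) -tx -tx' H0 (ltW c0).
rewrite mulr_ge0 ?(le_trans _ p2) // => /(_ isT isT isT kG) [k1 k2 k3].
have [t ht] := natrP (natr_norm_int (lr_unit_trace_int hO Ox nx)).
have [t' ht'] := natrP (natr_norm_int (lr_unit_trace_int hO Ox' nx')).
have cE : c = `|C|%N%:R.
  have C0 : 0 <= C.
    by rewrite !mulr_ge0 ?subr_ge0 ?addr_ge0 ?mulr_ge0 // (le_trans _ P2).
  by rewrite natr_absz (ger0_norm C0) /C /c /p !(intrM, intrB, intrD).
have pt : primitive_traces O t.
  split; first by rewrite -(ltr_nat rat) -ht (le_lt_trans H2).
  exists x; split => //; apply: (HF1 _ _ _ _ _ Ogb rv Hx).
  exact: le_lt_trans k1.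
have pt' : primitive_traces O t'.
  split; first by rewrite -(ltr_nat rat) -ht' (le_lt_trans H2).
  exists x'; split => //; apply: (HF2 _ _ _ _ _ Ogb rv Hx').
  exact: le_lt_trans k2.
have Kt : (K <= t)%N by rewrite -(ler_nat rat) -ht (le_trans HK) ?ltW.
have Kt' : (K <= t')%N by rewrite -(ler_nat rat) -ht' (le_trans HK) ?ltW.
(* Which of the two traces is the smaller depends on the sign of [kap]. *)
move: k3; rewrite ht ht' cE -!natrD => -[] /eqP; rewrite eqr_nat => /eqP E;
  [exists t, t' | exists t', t]; split=> //;
  by rewrite ?Kt ?Kt' E leqnn andbT -[ltnLHS]addn0 ltn_add2l -(ltr_nat rat) -cE.
Qed.

(** * Exchanging i and j; splitting by squares *)

Section Swap.
Variables (F : fieldType) (a b : F).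

(** The sign comes from [ij] being sent to [ji = - ij]. *)
Definition quat_swap (x : quat a b) : quat b a :=
  Quat (qre x) (qj x) (qi x) (- qij x).

Fact quat_swap_linear : linear quat_swap.
Proof. by move=> c [? ? ? ?] [? ? ? ?]; congr Quat => /=; ring. Qed.
Fact quat_swap_monoid : monoid_morphism quat_swap.
Proof.
split; first by congr Quat => /=; ring.
by move=> [? ? ? ?] [? ? ? ?]; congr Quat => /=; ring.
Qed.
HB.instance Definition _ :=
  GRing.isLinear.Build F (quat a b) (quat b a) _ quat_swap quat_swap_linear.
HB.instance Definition _ :=
  GRing.isMonoidMorphism.Build (quat a b) (quat b a) quat_swap quat_swap_monoid.

Lemma nrd_swap x : nrd (quat_swap x) = nrd x.
Proof. by case: x => ? ? ? ?; rewrite /nrd /=; ring. Qed.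

End Swap.

Lemma quat_swapK (F : fieldType) (a b : F) :
  cancel (@quat_swap F a b) (@quat_swap F b a).
Proof. by case=> ? ? ? ?; congr Quat => /=; rewrite opprK. Qed.

Section SquareSplit.
Variables (F : fieldType) (b c : F).
Hypotheses (b0 : b != 0) (c0 : c != 0) (two0 : 2%:R != 0 :> F).
Local Notation Q := (quat (c ^+ 2) b).

(** The representation with [i] acting as [diag(c, -c)] and [j] as the matrix with rows [(0, b)] and
    [(1, 0)]. *)
Definition quat_mx (x : Q) : 'M[F]_2 :=
  \matrix_(i < 2, j < 2) nth 0 (nth [::]
    [:: [:: qre x + c * qi x; b * (qj x + c * qij x)];
        [:: qj x - c * qij x; qre x - c * qi x]] i) j.

Definition mx_quat (A : 'M[F]_2) : Q :=
  Quat ((A 0 0 + A 1 1) / 2%:R) ((A 0 0 - A 1 1) / (2%:R * c))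
       ((A 0 1 / b + A 1 0) / 2%:R) ((A 0 1 / b - A 1 0) / (2%:R * c)).

Lemma matrix2P (A B : 'M[F]_2) : A 0 0 = B 0 0 -> A 0 1 = B 0 1 ->
  A 1 0 = B 1 0 -> A 1 1 = B 1 1 -> A = B.
Proof.
move=> e00 e01 e10 e11; apply/matrixP => i j.
have ord2 (k : 'I_2) : k = 0 \/ k = 1.
  by case: k => [[|[|//]] hk]; [left | right]; apply/val_inj.
by case: (ord2 i) (ord2 j) => -> [] ->.
Qed.

Fact quat_mx_linear : linear quat_mx.
Proof.
move=> k [? ? ? ?] [? ? ? ?]; apply: matrix2P; rewrite !mxE /=; ring.
Qed.
Fact quat_mx_monoid : monoid_morphism quat_mx.
Proof.
split; first by apply: matrix2P; rewrite !mxE /=; ring.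
move=> [? ? ? ?] [? ? ? ?].
by apply: matrix2P; rewrite !mxE /= !big_ord_recl big_ord0 !mxE /=; ring.
Qed.
HB.instance Definition _ :=
  GRing.isLinear.Build F Q 'M[F]_2 _ quat_mx quat_mx_linear.
HB.instance Definition _ :=
  GRing.isMonoidMorphism.Build Q 'M[F]_2 quat_mx quat_mx_monoid.

Lemma quat_mx_bij : bijective quat_mx.
Proof.
exists mx_quat; first by case=> ? ? ? ?; congr Quat; rewrite !mxE /=; field;
  rewrite ?b0 ?c0 ?two0.
by move=> A; apply: matrix2P; rewrite !mxE /=; field; rewrite ?b0 ?c0 ?two0.
Qed.

Lemma quat_split_square : quat_split (c ^+ 2) b.
Proof. by exists (quat_mx : {lrmorphism Q -> 'M[F]_2}); exact: quat_mx_bij. Qed.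

End SquareSplit.

Lemma quat_split_swap (F : fieldType) (a b : F) : quat_split a b -> quat_split b a.
Proof.
case=> f [g fK gK]; pose h := f \o @quat_swap F b a.
exists (h : {lrmorphism quat b a -> 'M[F]_2}).
exists (@quat_swap F a b \o g).
  by move=> x; rewrite /h /= fK quat_swapK.
by move=> A; rewrite /h /= quat_swapK gK.
Qed.

Lemma nonsplit_nonsquare (a b : rat) : a != 0 -> b != 0 -> ~ quat_split a b ->
  forall c : rat, c ^+ 2 != a.
Proof.
move=> a0 b0 ns c; apply/negP => /eqP ca; apply: ns; rewrite -ca.
by apply: quat_split_square => //; rewrite -sqrf_eq0 ca.
Qed.

Section LatticeSwap.
Variables (a b : rat) (O : set (quat a b)).
Hypothesis hO : lattice_ring O.
Let O' : set (quat b a) := [set x | O (quat_swap x)].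

Lemma lattice_ring_swap : lattice_ring O'.
Proof.
split.
- by rewrite /O' /= rmorph1; exact: (lr1 hO).
- by move=> x y; rewrite /O' /= rmorphB; exact: (lrB hO).
- by move=> x y; rewrite /O' /= rmorphM; exact: (lrM hO).
- move=> x; have [n n0 Hn] := lr_multiple hO (quat_swap x).
  by exists n => //; rewrite /O' /= rmorphMz.
- move=> f fB; have [|D D0 HD] := lr_denominator hO (f := f \o @quat_swap _ a b).
    by move=> x y /=; rewrite rmorphB fB.
  by exists D => // x /HD; rewrite /= quat_swapK.
Qed.

Lemma primitive_traces_swap : primitive_traces O' `<=` primitive_traces O.
Proof.
move=> t [t2 [x [Ox nx tx Hx]]]; split => //; exists (quat_swap x); split => //.
  by rewrite nrd_swap.
move=> y k s Oy ny k1; apply: contraTneq (Hx (quat_swap y) k s _ _ k1) => //.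
- move=> /(congr1 (@quat_swap _ a b)); rewrite quat_swapK => ->.
  by rewrite rmorphM rmorph_sign rmorphXn eqxx.
- by rewrite /O' /= quat_swapK.
- by rewrite nrd_swap.
Qed.

End LatticeSwap.

Lemma close_primitive_traces (R : realType) (a b : rat) (O : set (quat a b)) :
  a != 0 -> b != 0 -> ~ quat_split a b -> (0 < a) || (0 < b) -> lattice_ring O ->
  exists c : nat, forall K : nat, exists t t' : nat,
    [/\ primitive_traces O t, primitive_traces O t' &
        [&& K <= t, t < t' & t' <= t + c]%N].
Proof.
move=> a0 b0 ns ab hO.
have ns' : ~ quat_split b a by move/quat_split_swap.
have aN := nonsplit_nonsquare a0 b0 ns; have bN := nonsplit_nonsquare b0 a0 ns'.
(* 1 is a square, while [a] and [b] are not. *)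
have [b1 a1] : b != 1 /\ a != 1.
  by split; rewrite eq_sym -(expr1n _ 2).
case/orP: ab => [ap | bp]; first exact: (close_primitive_traces_nonsquare R).
have [c Hc] := close_primitive_traces_nonsquare R (lattice_ring_swap hO) bp bN a0 a1.
exists c => K; have [t [t' [Ht Ht' Htt']]] := Hc K.
by exists t, t'; split => //; exact: primitive_traces_swap.
Qed.

(** * Gaps between norms *)

(** Each term is the least element of [T] beyond the previous one. A missed [t] would exceed every
    [e n], yet [e n >= n]. *)
Lemma infinite_nat_enumeration (T : set nat) :
  (forall K : nat, exists2 t : nat, T t & (K <= t)%N) ->
  exists e : nat -> nat, (forall n, (e n < e n.+1)%N) /\ range e = T.
Proof.
move=> Tinf; have Tinf' K : exists t, `[< T t >] && (K <= t)%N.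
  by have [t /asboolP Tt Kt] := Tinf K; exists t; rewrite Tt.
pose nxt K := ex_minn (Tinf' K).
have nxtT K : T (nxt K) by rewrite /nxt; case: ex_minnP => t /andP[/asboolP].
have nxt_ge K : (K <= nxt K)%N by rewrite /nxt; case: ex_minnP => t /andP[_].
have nxt_min K t : T t -> (K <= t)%N -> (nxt K <= t)%N.
  by move=> /asboolP Tt Kt; rewrite /nxt; case: ex_minnP => u _; apply; rewrite Tt.
pose e n := iter n (fun k => nxt k.+1) (nxt 0).
have eT n : T (e n) by case: n => [|n]; exact: nxtT.
have e_lt n : (e n < e n.+1)%N by exact: nxt_ge.
exists e; split=> //; apply/seteqP; split=> [_ [n _ <-] //|t Tt /=].
apply: contrapT => tN; have lt_et n : (e n < t)%N.
  have ne m : e m != t by apply/eqP => emt; apply: tN; exists m.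
  elim: n => [|n IH]; rewrite ltn_neqAle ne /=; exact: nxt_min.
have e_ge n : (n <= e n)%N by elim: n => // n IH; exact: leq_ltn_trans (e_lt n).
by have := leq_ltn_trans (e_ge t) (lt_et t); rewrite ltnn.
Qed.

(** If [t = e k], the next value [e k.+1] is at most [t'], as [t'] is a later value of [e]. *)
Lemma close_enumeration (T : set nat) (c : nat) (e : nat -> nat) :
  (forall K : nat, exists t t' : nat,
    [/\ T t, T t' & [&& K <= t, t < t' & t' <= t + c]%N]) ->
  (forall n, (e n < e n.+1)%N) -> range e = T ->
  forall n, exists2 k, (n <= k)%N & (e k.+1 <= e k + c)%N.
Proof.
move=> Tc e_lt eT n; have [t [t' [+ + /and3P[nt tt' t'c]]]] := Tc (e n).
rewrite -eT => -[k _ kt] [k' _ kt'].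
have e_mono : {homo e : i j / (i < j)%N} by exact: (homo_ltn ltn_trans).
have e_mono' : {mono e : i j / (i <= j)%N} by exact: leq_mono.
exists k; first by rewrite -e_mono' kt.
rewrite kt (leq_trans _ t'c) // -kt' e_mono' ltnNge; apply/negP.
by rewrite -e_mono' kt kt' leqNgt tt'.
Qed.

Section Gap.
Variable R : realType.
Implicit Types (x : R^nat) (l m : R).

(** The lower bound takes every gap; for the upper one, a small gap in each tail bounds all tail
    infima. *)
Lemma LG_bounds x (c d : R) : (forall n, c <= `|x n.+1 - x n|) ->
  (forall n, exists2 k, (n <= k)%N & `|x k.+1 - x k| <= d) ->
  (c%:E <= LG x <= d%:E)%E.
Proof.
move=> xc xd; rewrite /LG limn_einf_lim; apply/andP; split.
  apply: lime_ge; first exact: is_cvg_einfs.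
  apply: nearW => n; apply: le_ereal_inf_tmp => _ [k _ <-].
  by rewrite lee_fin.
apply: lime_le; first exact: is_cvg_einfs.
apply: nearW => n; have [k nk xk] := xd n.
apply: (@le_trans _ _ (`|x k.+1 - x k|)%:E); last by rewrite lee_fin.
by apply: ereal_inf_lbound; exists k.
Qed.

(** The larger root of [X^2 - t X + 1]: the norm of a hyperbolic element of absolute trace [t]. *)
Definition large_root (t : nat) : R := (t%:R + Num.sqrt (t%:R ^+ 2 - 4%:R)) / 2%:R.

Lemma large_rootP (t : nat) : (2 < t)%N ->
  1 < large_root t /\ large_root t + (large_root t)^-1 = t%:R.
Proof.
move=> t2; have t3 : 3%:R <= t%:R :> R by rewrite ler_nat.
have D0 : 0 <= t%:R ^+ 2 - 4%:R :> R by nra.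
have s2 := sqr_sqrtr D0; have s0 := sqrtr_ge0 (t%:R ^+ 2 - 4%:R : R).
rewrite /large_root; move: (Num.sqrt _) s2 s0 => s s2 s0.
have L1 : 1 < (t%:R + s) / 2%:R by lra.
have L0 : (t%:R + s) / 2%:R != 0 :> R by apply: lt0r_neq0; lra.
split => //; apply: (mulIf L0); rewrite mulrDl mulVf //; nra.
Qed.

(** The difference of the two sums is [(m - l) (l m - 1) / (l m)]. *)
Lemma ler_addV l m : 1 < l -> 1 < m -> (l + l^-1 <= m + m^-1) = (l <= m).
Proof.
move=> l1 m1; have l0 : l != 0 by apply: lt0r_neq0; lra.
have m0 : m != 0 by apply: lt0r_neq0; lra.
rewrite -subr_ge0 -[RHS]subr_ge0.
have -> : m + m^-1 - (l + l^-1) = (m - l) * ((l * m - 1) / (l * m)).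
  by field; rewrite l0 m0.
rewrite pmulr_lge0 // divr_gt0 ?mulr_gt0 ?subr_gt0 //; try lra.
by rewrite mulr_egt1 // ltW.
Qed.

Lemma large_root_uniq (t : nat) l : (2 < t)%N -> 1 < l -> l + l^-1 = t%:R ->
  l = large_root t.
Proof.
move=> t2 l1 lt; have [L1 Lt] := large_rootP t2.
by apply/le_anti; rewrite -(ler_addV l1 L1) -(ler_addV L1 l1) Lt lt lexx.
Qed.

(** The root differs from [t] by its inverse, which decreases with [t] and stays between 0 and 1. *)
Lemma large_root_gap (s t : nat) : (2 < s)%N -> (s < t)%N ->
  (t - s)%:R <= large_root t - large_root s <= (t - s)%:R + 1.
Proof.
move=> s2 st; have t2 : (2 < t)%N by exact: ltn_trans st.
have [Ls1 Ls] := large_rootP s2; have [Lt1 Lt] := large_rootP t2.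
have LL : large_root s <= large_root t by rewrite -ler_addV // Ls Lt ler_nat ltnW.
rewrite natrB ?(ltnW st) // -Ls -Lt.
have : (large_root t)^-1 <= (large_root s)^-1.
  by rewrite lef_pV2 ?posrE //; lra.
have : (large_root s)^-1 <= 1 by rewrite invf_le1; lra.
have : 0 <= (large_root t)^-1 by rewrite invr_ge0; lra.
by move: (_^-1) (_^-1) => u v *; lra.
Qed.

(** Distinct integers in [T] keep all gaps at least 1, and the close pairs make infinitely many gaps
    at most [c + 1]. *)
Lemma bounded_gaps_image (Gamma : set (PSL2 R)) (T : set nat) (c : nat) :
  (forall t, T t -> (2 < t)%N) ->
  (forall K : nat, exists t t' : nat,
    [/\ T t, T t' & [&& K <= t, t < t' & t' <= t + c]%N]) ->
  norm_set Gamma = large_root @` T -> bounded_gaps_group Gamma.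
Proof.
move=> T2 Tc GT; have [e [e_lt eT]] : exists e : nat -> nat,
    (forall n, (e n < e n.+1)%N) /\ range e = T.
  apply: infinite_nat_enumeration => K.
  by have [t [_ [Tt _ /andP[Kt _]]]] := Tc K; exists t.
have e2 n : (2 < e n)%N by apply: T2; rewrite -eT; exists n.
have gap n := large_root_gap (e2 n) (e_lt n).
have gap1 n : 1 <= large_root (e n.+1) - large_root (e n).
  have /andP[+ _] := gap n; apply: le_trans.
  by rewrite (ler_nat _ 1) subn_gt0.
exists (large_root \o e); split.
  split=> [n|] /=; first by rewrite -subr_gt0 (lt_le_trans _ (gap1 n)).
  by rewrite GT -eT image_comp.
have /andP[l1 l2] : (1%:E <= LG (large_root \o e) <= (c%:R + 1)%:E)%E.
  apply: LG_bounds => n /=; first by rewrite (le_trans (gap1 n)) ?ler_norm.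
  have [k nk ek] := close_enumeration Tc e_lt eT n; exists k => //.
  rewrite ger0_norm ?(le_trans _ (gap1 k)) //; have /andP[_] := gap k.
  by move/le_trans; apply; rewrite lerD2r ler_nat leq_subLR.
by rewrite (lt_le_trans _ l1) ?lte_fin // (le_lt_trans l2) ?ltry.
Qed.

End Gap.

(** * Characteristic polynomials of two by two matrices *)

Lemma mul_XsubC (F : comNzRingType) (c d : F) :
  ('X - c%:P) * ('X - d%:P) = 'X^2 - (c + d) *: 'X + (c * d)%:P.
Proof. by rewrite -mul_polyC polyCD polyCM; ring. Qed.

Section Matrix2.
Variable F : fieldType.
Implicit Type A : 'M[F]_2.

Lemma det_mx2 A : \det A = A 0 0 * A 1 1 - A 0 1 * A 1 0.
Proof.
rewrite (expand_det_row _ 0) !big_ord_recl big_ord0 /cofactor !det_mx11 !mxE /=.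
have -> : lift 0 (0 : 'I_1) = 1 :> 'I_2 by apply/val_inj.
have -> : lift 1 (0 : 'I_1) = 0 :> 'I_2 by apply/val_inj.
transitivity (A 0 0 * ((-1) ^+ 0 * A 1 1) + (A 0 1 * ((-1) ^+ 1 * A 1 0) + 0)).
  by [].
by ring.
Qed.

Lemma mxtrace2 A : \tr A = A 0 0 + A 1 1.
Proof.
rewrite /mxtrace !big_ord_recl big_ord0 addr0; congr (_ + A _ _);
  exact/val_inj.
Qed.

Lemma det_sub1 A : \det (A - 1%:M) = \det A - \tr A + 1.
Proof. by rewrite !det_mx2 mxtrace2 !mxE /=; ring. Qed.

Lemma char_poly2 A : char_poly A = 'X^2 - \tr A *: 'X + (\det A)%:P.
Proof.
have sA := size_char_poly A.
have lA : (char_poly A)`_2 = 1.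
  by have /monicP := char_poly_monic A; rewrite /lead_coef sA.
apply/polyP => -[|[|[|k]]]; rewrite coefD coefB coefZ coefXn coefX coefC /=.
- by rewrite char_poly_det; ring.
- by rewrite char_poly_trace //; ring.
- by rewrite lA; ring.
- by rewrite nth_default ?sA //; ring.
Qed.

End Matrix2.

(** * The unit group in PSL2 *)

Section RealEmbedding.
Variables (R : realType) (a b : rat).
Local Notation MR := (quat (ratr a : R) (ratr b)).
Local Notation iota := (@quat_ratr R a b).
Implicit Types x y : quat a b.

Fact quat_ratrB : zmod_morphism iota.
Proof. by case=> ? ? ? ? [? ? ? ?]; congr Quat => /=; rewrite rmorphB. Qed.
Fact quat_ratr_monoid : monoid_morphism iota.
Proof.
split; first by congr Quat; rewrite /= ?rmorph0 ?rmorph1.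
move=> [? ? ? ?] [? ? ? ?].
by congr Quat => /=; rewrite !(rmorphD, rmorphN, rmorphM).
Qed.
HB.instance Definition _ :=
  GRing.isZmodMorphism.Build (quat a b) MR iota quat_ratrB.
HB.instance Definition _ :=
  GRing.isMonoidMorphism.Build (quat a b) MR iota quat_ratr_monoid.

Lemma nrd_quat_ratr x : nrd (iota x) = ratr (nrd x).
Proof. by rewrite /nrd /= !(rmorphD, rmorphN, rmorphM, rmorphXn). Qed.

Lemma quat_ratr_inj : injective iota.
Proof.
have inj : injective (ratr : rat -> R) := fmorph_inj _.
by case=> ? ? ? ? [? ? ? ?] [] /inj -> /inj -> /inj -> /inj ->.
Qed.

End RealEmbedding.

Lemma SL2_expE (F : fieldType) (g : SL2 F) (k : nat) :
  (g ^+ k)%g = (g : 'M[F]_2) ^+ k :> 'M[F]_2.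
Proof.
elim: k => [|k IH]; first by rewrite expg0 expr0.
by rewrite expgS exprS -IH.
Qed.

Lemma toPSL2X (F : fieldType) (g : SL2 F) (k : nat) :
  toPSL2 (g ^+ k)%g = (toPSL2 g ^+ k)%g.
Proof.
elim: k => [|k IH]; first by rewrite !expg0.
by rewrite !expgS -IH -toPSL2M.
Qed.

Section UnitGroup.
Variables (R : realType) (a b : rat).
Variable phi : {lrmorphism quat (ratr a : R) (ratr b) -> 'M[R]_2}.
Hypotheses (phi_bij : bijective phi)
  (phi_det : forall alpha, nrd alpha = \det (phi alpha)).
Variable O : set (quat a b).
Hypothesis hO : lattice_ring O.
Local Notation iota := (@quat_ratr R a b).

(** If [a] and [b] were negative, the real norm form would be positive definite, but the preimage of
    a rank one matrix is a nonzero element of norm 0. *)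
Lemma indefinite : a != 0 -> b != 0 -> (0 < a) || (0 < b).
Proof.
move=> a0 b0; rewrite -[_ || _]negbK negb_or -!leNgt !le_eqVlt (negPf a0) (negPf b0) /=.
apply/negP => /andP[an bn].
have [psi phiK psiK] := phi_bij.
pose E : 'M[R]_2 := delta_mx 0 0.
have E0 : psi E = 0.
  have : nrd (psi E) = 0 by rewrite phi_det psiK det_mx2 !mxE /=; ring.
  have {}an : ratr a < 0 :> R by rewrite -(rmorph0 (ratr : rat -> R)) ltr_rat.
  have {}bn : ratr b < 0 :> R by rewrite -(rmorph0 (ratr : rat -> R)) ltr_rat.
  case: (psi E) => x y z w; rewrite /nrd /= => H.
  have hx := sqr_ge0 x.
  have hy : 0 <= - ratr a * y ^+ 2 by rewrite mulr_ge0 ?sqr_ge0 ?oppr_ge0 ?ltW.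
  have hz : 0 <= - ratr b * z ^+ 2 by rewrite mulr_ge0 ?sqr_ge0 ?oppr_ge0 ?ltW.
  have ab : 0 < ratr a * ratr b :> R by rewrite nmulr_rgt0.
  have hw : 0 <= ratr a * ratr b * w ^+ 2 by rewrite mulr_ge0 ?sqr_ge0 ?ltW.
  have x0 : x ^+ 2 = 0 by lra.
  have y0 : ratr a * y ^+ 2 = 0 by lra.
  have z0 : ratr b * z ^+ 2 = 0 by lra.
  have w0 : ratr a * ratr b * w ^+ 2 = 0 by lra.
  move/eqP: x0; rewrite sqrf_eq0 => /eqP->.
  move/eqP: y0; rewrite mulf_eq0 lt_eqF // sqrf_eq0 => /eqP->.
  move/eqP: z0; rewrite mulf_eq0 lt_eqF // sqrf_eq0 => /eqP->.
  by move/eqP: w0; rewrite mulf_eq0 gt_eqF // sqrf_eq0 => /eqP->.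
have := psiK E; rewrite E0 rmorph0 => /matrixP /(_ 0 0) /eqP.
by rewrite !mxE /= eq_sym oner_eq0.
Qed.

(** The norms of [alpha] and [alpha - 1] determine the trace, and [phi] turns norms into
    determinants. *)
Lemma mxtrace_phi alpha : \tr (phi alpha) = 2%:R * qre alpha.
Proof.
have := phi_det (alpha - 1); rewrite nrd_subr1 rmorphB rmorph1 /= det_sub1 -phi_det.
by lra.
Qed.

Lemma unit_lift (x : quat a b) : nrd x = 1 ->
  {g : SL2 R | g = phi (iota x) :> 'M[R]_2}.
Proof.
move=> nx; have dx : \det (phi (iota x)) == 1.
  by rewrite -phi_det nrd_quat_ratr nx rmorph1.
by exists (MkSL2 dx).
Qed.

(** By injectivity of [phi] after [iota], an equality of powers in [PSL2] is one in [O] up to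
    sign. *)
Lemma primitive_liftP (x : quat a b) (g : SL2 R) : O x -> nrd x = 1 ->
  g = phi (iota x) :> 'M[R]_2 ->
  primitive (quat_unit_group O phi) (toPSL2 g) <->
  forall y (k : nat) (s : bool), O y -> nrd y = 1 -> (1 < k)%N ->
    x != (-1) ^+ s * y ^+ k.
Proof.
move=> Ox nx gx; split.
  move=> prim y k s Oy ny k1; apply/eqP => xy; apply: prim.
  have [h hy] := unit_lift ny.
  exists (toPSL2 h), k; split => //; first by exists y, h.
  rewrite -toPSL2X; apply/eqP/toPSL2_eq.
  rewrite gx SL2_expE hy xy -!rmorphXn.
  by case: s {xy}; [right | left]; rewrite ?mulN1r ?mul1r // !rmorphN.
move=> nonpow [_ [k [[y [h [Oy ny hy <-]]] k1 /eqP]]].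
rewrite -toPSL2X => /toPSL2_eq; rewrite gx SL2_expE hy -!rmorphXn.
have inj : injective (phi \o iota).
  by apply: inj_comp; [exact: bij_inj | exact: quat_ratr_inj].
case=> [|]; last rewrite -!rmorphN; move/inj => xy.
  by have := nonpow y k false Oy ny k1; rewrite mul1r xy eqxx.
by have := nonpow y k true Oy ny k1; rewrite mulN1r xy eqxx.
Qed.

(** Lifts of an element of norm [l] have trace [l + l^-1] up to sign, an integer up to sign by
    [lr_unit_trace_int]; [l] is recovered as its [large_root]. *)
Lemma norm_set_traces :
  norm_set (quat_unit_group O phi) = @large_root R @` primitive_traces O.
Proof.
apply/seteqP; split=> [l [gamma [[x [g [Ox nx gx gg]]] _ prim [l1 [g' [s [gg' cp]]]]]] |
    _ [t [t2 [x [Ox nx tx nonpow]]] <-]].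
  have trg : \tr (g : 'M[R]_2) = ratr (2%:R * qre x).
    by rewrite gx mxtrace_phi /= rmorphM /= ratr_nat.
  have trg' : \tr (g' : 'M[R]_2) = (-1) ^+ s * (l + l^-1).
    move/(congr1 (fun p : {poly R} => p`_1)): cp.
    rewrite char_poly2 mul_XsubC !coefD !coefN !coefZ !coefXn !coefX !coefC /=.
    by rewrite -mulrDr; lra.
  have trgg' : `|\tr (g : 'M[R]_2)| = `|\tr (g' : 'M[R]_2)|.
    have /eqP/toPSL2_eq[->|->] : toPSL2 g = toPSL2 g' by rewrite gg gg'.
      by [].
    by rewrite raddfN normrN.
  have lV0 : 0 < l^-1 by rewrite invr_gt0; lra.
  have [t ht] := natrP (natr_norm_int (lr_unit_trace_int hO Ox nx)).
  have lt : l + l^-1 = t%:R.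
    rewrite -(ratr_nat R t) -ht ratr_norm -trg trgg' trg' normrM normr_sign mul1r.
    by rewrite ger0_norm //; lra.
  have t2 : (2 < t)%N.
    rewrite -(ltr_nat R) -lt -subr_gt0.
    have -> : l + l^-1 - 2%:R = (l - 1) ^+ 2 * l^-1 by field; apply: lt0r_neq0; lra.
    by rewrite mulr_gt0 // exprn_even_gt0 //= subr_eq0 gt_eqF.
  exists t; last by rewrite (large_root_uniq t2 l1 lt).
  split=> //; exists x; split => //.
  by apply/(primitive_liftP Ox nx gx); rewrite gg.
have [g gx] := unit_lift nx; have [L1 Lt] := large_rootP R t2.
have trg : \tr (g : 'M[R]_2) = ratr (2%:R * qre x).
  by rewrite gx mxtrace_phi /= rmorphM /= ratr_nat.
have ntrg : `|\tr (g : 'M[R]_2)| = t%:R by rewrite trg -ratr_norm tx ratr_nat.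
exists (toPSL2 g); split.
- by exists x, g.
- by exists g; rewrite ntrg ltr_nat.
- exact/(primitive_liftP Ox nx gx).
(* Both eigenvalues carry the sign of the trace. *)
split => //; exists g, (\tr (g : 'M[R]_2) < 0); split => //.
have L0 : large_root R t != 0 by apply: lt0r_neq0; lra.
rewrite char_poly2 mul_XsubC SL2P -mulrDr Lt -ntrg -realEsign ?num_real //.
by rewrite mulrACA -expr2 sqrr_sign mul1r divff.
Qed.

End UnitGroup.

Theorem theorem2p2 (R : realType) (a b : rat) (ha : a != 0) (hb : b != 0)
    (nonsplit : ~ quat_split a b)
    (phi : {lrmorphism quat (ratr a : R) (ratr b) -> 'M[R]_2})
    (phi_bij : bijective phi)
    (phi_det : forall alpha, nrd alpha = \det (phi alpha))
    (O : set (quat a b)) (hO : is_maximal_order O) :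
  bounded_gaps_group (quat_unit_group O phi).
Proof.
have lO : lattice_ring O by apply: lattice_ring_order; case: hO.
have ab := indefinite phi_bij phi_det ha hb.
have [c Hc] := close_primitive_traces R ha hb nonsplit ab lO.
apply: (bounded_gaps_image _ Hc (norm_set_traces phi_bij phi_det lO)).
by move=> t [].
Qed.
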